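(* Let $G$ be an swm-graph and $p,q$ vertices of $G$, with $k=d_{G^{\Delta}}(p,q)$. There is a unique normal Boolean-gated path $\gamma_{pq}=(p=x_0,x_1,\ldots,x_k=q)$ from $p$ to $q$, and its vertices are given recursively by $x_k=q$ and, for $i=k-1,k-2,\ldots,0$, $x_i$ is the $\Delta$--gate of $p$ at $x_{i+1}$. In particular, any normal Boolean-gated path is a shortest path of $G^{\Delta}$.
   Context: Graphs are simple, undirected, connected, possibly infinite; $d$ is distance in $G$, $I(u,v)=\{x:d(u,x)+d(x,v)=d(u,v)\}$. Weakly modular: for every vertex $u$, (TC) for $v,w$ with $1=d(v,w)<d(u,v)=d(u,w)$ there is a common neighbor $x$ of $v,w$ with $d(u,x)=d(u,v)-1$, and (QC) for $v,w,z$ with $d(v,z)=d(w,z)=1$, $2=d(v,w)\le d(u,v)=d(u,w)=d(u,z)-1$ there is a common neighbor $x$ of $v,w$ with $d(u,x)=d(u,v)-1$. An swm-graph is a weakly modular graph without induced $K_4^-$ and isometric $K_{3,3}^-$. A set $X$ is gated if each vertex $x$ has a (unique) gate $x'\in X$ with $x'\in I(x,y)$ for all $y\in X$; $\langle x,y\rangle$ denotes the smallest gated set containing $x,y$. A Boolean-gated set is a gated set inducing a thick subgraph (every $I(u,v)$ with $d(u,v)=2$ contains an induced $4$--cycle). A pair $(x,y)$ is Boolean if the subgraph induced by $I(x,y)$ contains an isometric $d(x,y)$--cube. $G^{\Delta}$ is the graph on $V(G)$ whose edges are the pairs that are adjacent in $G$ or are Boolean pairs at distance $\ge2$; $d_{G^{\Delta}}$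 is its distance. For vertices $a,b$ with $a\neq b$, the $\Delta$--gate of $a$ at $b$ is the gate of $b$ in the vertex set $\{z: d_{G^{\Delta}}(a,z)\le d_{G^{\Delta}}(a,b)-1\}$ (a ball of $G^{\Delta}$, which is a gated subset of $G$). A path $(x_0,\ldots,x_k)$ of $G^{\Delta}$ is a normal Boolean-gated path if for every $i=1,\ldots,k-1$ and every Boolean-gated set $B$ containing $\langle x_{i-1},x_i\rangle$ one has $B\cap\langle x_i,x_{i+1}\rangle=\{x_i\}$. *)

(* Defs.v *)
From Stdlib Require Import ClassicalEpsilon.
From mathcomp Require Import all_boot.

Set Implicit Arguments.
Unset Strict Implicit.
Unset Printing Implicit Defensive.

Section Graphs.
Variable V : Type.

Inductive walk (adj : V -> V -> Prop) : V -> V -> nat -> Prop :=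
| walk0 u : walk adj u u 0
| walkS u w v n : adj u w -> walk adj w v n -> walk adj u v n.+1.

(* graph distance: the least length of a walk (well defined in connected graphs) *)
Definition gdist (adj : V -> V -> Prop) (u v : V) : nat :=
  epsilon (inhabits 0%N)
    (fun n => walk adj u v n /\ forall m, walk adj u v m -> (n <= m)%N).

Definition simple_graph (adj : V -> V -> Prop) : Prop :=
  (forall u, ~ adj u u) /\ (forall u v, adj u v -> adj v u).

Definition connected (adj : V -> V -> Prop) : Prop :=
  forall u v, exists n, walk adj u v n.

Definition induced (adj : V -> V -> Prop) (X : V -> Prop) : V -> V -> Prop :=
  fun u v => X u /\ X v /\ adj u v.

Definition interval (adj : V -> V -> Prop) (u v x : V) : Prop :=
  (gdist adj u x + gdist adj x v)%N = gdist adj u v.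

Definition triangle_condition (adj : V -> V -> Prop) : Prop :=
  forall u v w, adj v w -> gdist adj u v = gdist adj u w -> (1 < gdist adj u v)%N ->
    exists x, adj x v /\ adj x w /\ gdist adj u x = (gdist adj u v).-1.

Definition quadrangle_condition (adj : V -> V -> Prop) : Prop :=
  forall u v w z, adj v z -> adj w z -> gdist adj v w = 2 ->
    (2 <= gdist adj u v)%N -> gdist adj u v = gdist adj u w ->
    gdist adj u z = (gdist adj u v).+1 ->
    exists x, adj x v /\ adj x w /\ gdist adj u x = (gdist adj u v).-1.

Definition weakly_modular (adj : V -> V -> Prop) : Prop :=
  triangle_condition adj /\ quadrangle_condition adj.

Definition no_induced_K4minus (adj : V -> V -> Prop) : Prop :=
  ~ exists a b c e : V,
      c <> e /\ adj a b /\ adj a c /\ adj a e /\ adj b c /\ adj b e /\ ~ adj c e.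

Definition no_isometric_K33minus (adj : V -> V -> Prop) : Prop :=
  ~ exists a1 a2 a3 b1 b2 b3 : V,
      gdist adj a1 a2 = 2 /\ gdist adj a1 a3 = 2 /\ gdist adj a2 a3 = 2 /\
      gdist adj b1 b2 = 2 /\ gdist adj b1 b3 = 2 /\ gdist adj b2 b3 = 2 /\
      gdist adj a1 b1 = 3 /\
      adj a1 b2 /\ adj a1 b3 /\ adj a2 b1 /\ adj a2 b2 /\ adj a2 b3 /\
      adj a3 b1 /\ adj a3 b2 /\ adj a3 b3.

Definition swm_graph (adj : V -> V -> Prop) : Prop :=
  simple_graph adj /\ connected adj /\ weakly_modular adj /\
  no_induced_K4minus adj /\ no_isometric_K33minus adj.

Definition is_gate (adj : V -> V -> Prop) (X : V -> Prop) (x g : V) : Prop :=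
  X g /\ forall y, X y -> interval adj x y g.

Definition gated (adj : V -> V -> Prop) (X : V -> Prop) : Prop :=
  forall x, exists g, is_gate adj X x g.

Definition gated_hull (adj : V -> V -> Prop) (x y : V) : V -> Prop :=
  fun z => forall X, gated adj X -> X x -> X y -> X z.

Definition thick_set (adj : V -> V -> Prop) (X : V -> Prop) : Prop :=
  let H := induced adj X in
  forall u v, X u -> X v -> gdist H u v = 2 ->
    exists a b c e : V,
      X a /\ X b /\ X c /\ X e /\
      interval H u v a /\ interval H u v b /\ interval H u v c /\ interval H u v e /\
      a <> c /\ b <> e /\
      adj a b /\ adj b c /\ adj c e /\ adj e a /\ ~ adj a c /\ ~ adj b e.

Definition boolean_gated (adj : V -> V -> Prop) (X : V -> Prop) : Prop :=
  gated adj X /\ thick_set adj X.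

Definition hamming (n : nat) (a b : 'I_n -> bool) : nat :=
  #|[pred i | a i != b i]|.

Definition boolean_pair (adj : V -> V -> Prop) (x y : V) : Prop :=
  exists f : ('I_(gdist adj x y) -> bool) -> V,
    (forall a, interval adj x y (f a)) /\
    (forall a b, gdist (induced adj (interval adj x y)) (f a) (f b) = hamming a b).

Definition adjDelta (adj : V -> V -> Prop) (u v : V) : Prop :=
  adj u v \/ (boolean_pair adj u v /\ (2 <= gdist adj u v)%N).

Definition distDelta (adj : V -> V -> Prop) : V -> V -> nat :=
  gdist (adjDelta adj).

Definition delta_gate (adj : V -> V -> Prop) (a b g : V) : Prop :=
  a <> b /\
  is_gate adj (fun z => (distDelta adj a z <= (distDelta adj a b).-1)%N) b g.

Definition normal_bg_path (adj : V -> V -> Prop) (x : nat -> V) (m : nat) : Prop :=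
  (forall i, (i < m)%N -> adjDelta adj (x i) (x i.+1)) /\
  (forall i, (1 <= i)%N -> (i < m)%N ->
     forall B, boolean_gated adj B ->
       (forall z, gated_hull adj (x i.-1) (x i) z -> B z) ->
       forall z, (B z /\ gated_hull adj (x i) (x i.+1) z) <-> z = x i).

End Graphs.

(* Main.v *)
(* Since the balls of G^Delta are gated, the gates of p define a path; it is normal because
   a Boolean-gated set through x_(i-1) lies in the i-th ball, whose gate for x_(i+1) is x_i.
   Conversely, on a normal path let g be the gate of x_(i+1) in the i-th ball. If g <> x_i,
   a neighbour v of x_i towards g forms squares with all neighbours of x_i towards x_(i-1),
   so v, x_i, x_(i-1) lie in one Boolean-gated set, which contradicts normality at v.

   Both this step and the gatedness of balls rest on one extension principle: if S is thick
   and gated and w is a neighbour of x in S forming squares with all neighbours of x in S,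
   then some thick gated set contains S and w and stays within distance 1 of S. It consists of
   S and of the component of w among the vertices at distance 1 from S that form squares in
   this way; at a vertex of S, the lines of this component behave like the points of an affine
   space whose hyperplane at infinity is given by S (Veblen's axiom, from cubes and the absence
   of K_{3,3}^-). Extending along geodesics and along cubes identifies the edges of
   G^Delta with the pairs of distinct vertices lying in a common thick gated set. *)

Require Import Defs.
From Stdlib Require Import Classical ClassicalEpsilon.
From mathcomp Require Import all_boot zify.

Set Implicit Arguments.
Unset Strict Implicit.
Unset Printing Implicit Defensive.

(** * Graph distance as shortest walk length *)

Lemma ex_least (P : nat -> Prop) :
  (exists n, P n) -> exists n, P n /\ forall m, P m -> n <= m.
Proof.
move=> [n Pn]; apply: NNPP => Hno.
have H : forall k m, m < k -> ~ P m.
  elim=> [|k IH] m // lt_mk Pm; apply: Hno; exists m; split=> // m' Pm'.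
  by case: (leqP m m') => // lt; case: (IH m' _ Pm'); lia.
exact: (H n.+1 n).
Qed.

Section Distance.
Variables (V : Type) (adj : V -> V -> Prop).

Lemma gdist_spec u v : (exists n, walk adj u v n) ->
  walk adj u v (gdist adj u v) /\ forall m, walk adj u v m -> gdist adj u v <= m.
Proof. by move=> /ex_least H; exact: (epsilon_spec _ _ H). Qed.

Lemma walk_cat u v w m n : walk adj u v m -> walk adj v w n -> walk adj u w (m + n).
Proof. by elim=> // {}u a {}v k ua _ IH vw; rewrite addSn; apply: walkS ua (IH vw). Qed.

Lemma walk1 u v : adj u v -> walk adj u v 1.
Proof. by move=> uv; apply: walkS uv (walk0 _ _). Qed.

Lemma walk_le_map (adj' : V -> V -> Prop) u v n :
  (forall a b, adj a b -> adj' a b) -> walk adj u v n -> walk adj' u v n.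
Proof. by move=> sub; elim=> [x|x y z k /sub xy _]; [apply: walk0|apply: walkS]. Qed.

Hypothesis adjC : forall u v, adj u v -> adj v u.

Lemma walkC u v n : walk adj u v n -> walk adj v u n.
Proof.
elim=> [x|x y z k /adjC yx _ zy]; first exact: walk0.
by rewrite -addn1; apply: walk_cat zy (walk1 yx).
Qed.

Hypothesis conn : connected adj.
Notation d := (gdist adj).

Lemma gdist_walk u v : walk adj u v (d u v).
Proof. exact: (gdist_spec (conn u v)).1. Qed.

Lemma gdist_min u v n : walk adj u v n -> d u v <= n.
Proof. exact: (gdist_spec (conn u v)).2. Qed.

Lemma gdistxx u : d u u = 0.
Proof. by have := gdist_min (walk0 adj u); lia. Qed.

Lemma gdist_eq0 u v : d u v = 0 -> u = v.
Proof. by move=> E; have := gdist_walk u v; rewrite E => W; inversion W. Qed.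

Lemma gdistC u v : d u v = d v u.
Proof.
have := gdist_min (walkC (gdist_walk u v)).
have := gdist_min (walkC (gdist_walk v u)); lia.
Qed.

Lemma gdist_tri v u w : d u w <= d u v + d v w.
Proof. exact: gdist_min (walk_cat (gdist_walk u v) (gdist_walk v w)). Qed.

Lemma gdist_adj1 u v : adj u v -> d u v <= 1.
Proof. by move=> uv; apply: gdist_min; apply: walk1. Qed.

Lemma gdist_eq1 u v : d u v = 1 -> adj u v.
Proof.
move=> E; have := gdist_walk u v; rewrite E => W; inversion W as [|? ? ? ? a b]; subst.
by inversion b; subst.
Qed.

Lemma gdist_step u v n : d u v = n.+1 -> exists w, adj u w /\ d w v = n.
Proof.
move=> E; have := gdist_walk u v; rewrite E => W; inversion W as [|? w ? ? a b]; subst.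
exists w; split=> //; have := gdist_min b; have := gdist_tri w u v.
have := gdist_adj1 a; lia.
Qed.

End Distance.

(** * Triangles, quadrangles, lines and squares in swm-graphs *)

Section SwmGraph.
Variables (V : Type) (adj : V -> V -> Prop).
Hypothesis HG : swm_graph adj.
Notation d := (gdist adj).

Lemma adjC u v : adj u v -> adj v u. Proof. exact: HG.1.2. Qed.
Lemma adjN u : ~ adj u u. Proof. exact: HG.1.1. Qed.
Lemma conn : connected adj. Proof. exact: HG.2.1. Qed.

Lemma dxx u : d u u = 0. Proof. exact: gdistxx conn u. Qed.
Lemma d0 u v : d u v = 0 -> u = v. Proof. exact: gdist_eq0 conn u v. Qed.
Lemma dC u v : d u v = d v u. Proof. exact: gdistC adjC conn u v. Qed.
Lemma dT v u w : d u w <= d u v + d v w. Proof. exact: gdist_tri conn v u w. Qed.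
Lemma d1 u v : d u v = 1 -> adj u v. Proof. exact: gdist_eq1 conn u v. Qed.
Lemma step u v n : d u v = n.+1 -> exists w, adj u w /\ d w v = n.
Proof. exact: gdist_step conn u v n. Qed.

Lemma d_adj u v : adj u v -> d u v = 1.
Proof.
move=> uv; have := gdist_adj1 conn uv.
by case E: (d u v) => [|[|]] // _; move/d0: E uv => ->; move/adjN.
Qed.

Lemma d_pos u v : u <> v -> 0 < d u v.
Proof. by case E: (d u v) => //; move/d0: E. Qed.

Lemma lip o u v : adj u v -> d o u <= (d o v).+1 /\ d o v <= (d o u).+1.
Proof.
by move=> uv; have := dT v o u; have := dT u o v; rewrite (dC v u) (d_adj uv); lia.
Qed.

Lemma d2 u v w : adj u w -> adj w v -> u <> v -> ~ adj u v -> d u v = 2.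
Proof.
move=> uw wv /d_pos n nuv; have := dT w u v; rewrite (d_adj uw) (d_adj wv).
by case E: (d u v) n => [|[|[|]]] //; move/d1: E.
Qed.

Lemma d2_mid u v : d u v = 2 -> exists w, adj u w /\ adj w v.
Proof. by move=> /step [w [uw /d1 wv]]; exists w. Qed.

Lemma d2_neq u v : d u v = 2 -> u <> v /\ ~ adj u v.
Proof. by move=> E; split=> [|/d_adj]; [move=> e; move: E; rewrite e dxx|rewrite E]. Qed.

Lemma eq_adj_d2 u v w : adj u w -> adj w v -> [\/ u = v, adj u v | d u v = 2].
Proof.
move=> uw wv; case: (classic (u = v)) => [|n1]; first by constructor 1.
by case: (classic (adj u v)) => [|n2]; [constructor 2|constructor 3; apply: d2 uw wv _ _].
Qed.

Lemma K4 a b c e : adj a b -> adj a c -> adj a e -> adj b c -> adj b e -> c = e \/ adj c e.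
Proof.
move=> ab ac ae bc be; apply: NNPP => H; apply: (HG.2.2.2.1).
by exists a, b, c, e; split=> [E|]; [apply: H; left|do !split=> //; move=> ce; apply: H; right].
Qed.

Lemma TC u v w n : adj v w -> d u v = n.+1 -> d u w = n.+1 ->
  exists x, [/\ adj x v, adj x w & d u x = n].
Proof.
move=> vw Ev Ew; case: n Ev Ew => [|n] Ev Ew.
  by exists u; split; [apply: d1|apply: d1|apply: dxx].
case: (HG.2.2.1.1 u v w vw) => [||x [xv [xw Ex]]]; rewrite ?Ev ?Ew //.
by exists x; split=> //; rewrite Ex Ev.
Qed.

(** The triangle condition gives a vertex [x] on the edge [v w] one step closer to [u]; without
    induced K_4^- it equals [z] or is adjacent to it. *)
Lemma triangle_far u v w z n : adj v w -> adj z v -> adj z w ->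
  d u v = n -> d u w = n -> d u z <= n.
Proof.
move=> vw zv zw; case: n => [|n] Ev Ew.
  by move/d0: Ev vw => <-; move/d0: Ew => <- /adjN.
case: (TC vw Ev Ew) => x [xv xw Ex].
case: (K4 vw (adjC xv) (adjC zv) (adjC xw) (adjC zw)) => [<-|xz]; first lia.
have := lip u xz; lia.
Qed.

(** By [triangle_far], [v] and [w] are not adjacent, so distinctness can replace the distance 2 of
    [quadrangle_condition]; for [n = 0] the answer is [u] itself. *)
Lemma QC u v w z n : adj v z -> adj w z -> v <> w ->
  d u v = n.+1 -> d u w = n.+1 -> d u z = n.+2 ->
  exists x, [/\ adj x v, adj x w & d u x = n].
Proof.
move=> vz wz vw Ev Ew Ez.
have nvw : ~ adj v w.
  by move=> a; have := triangle_far a (adjC vz) (adjC wz) Ev Ew; lia.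
case: n Ev Ew Ez => [|n] Ev Ew Ez.
  by exists u; split; [apply: d1|apply: d1|apply: dxx].
have E2 := d2 vz (adjC wz) vw nvw.
case: (HG.2.2.1.2 u v w z vz wz E2) => [||//|x [xv [xw Ex]]]; rewrite ?Ev ?Ew //.
by exists x; split=> //; rewrite Ex Ev.
Qed.

Lemma d0_inj o u v : d o u = 0 -> d o v = 0 -> u = v.
Proof. by move=> /d0 <- /d0 <-. Qed.

(** With these eight edges, the distance 3 forces the distances 2 from [a1] and from [b1], and an
    edge [a2 a3] or [b2 b3] would create an induced K_4^-. *)
Lemma K33 a1 a2 a3 b1 b2 b3 : d a1 b1 = 3 -> a2 <> a3 -> b2 <> b3 ->
  adj a1 b2 -> adj a1 b3 -> adj a2 b1 -> adj a2 b2 -> adj a2 b3 ->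
  adj a3 b1 -> adj a3 b2 -> adj a3 b3 -> False.
Proof.
move=> E3 na nb a1b2 a1b3 a2b1 a2b2 a2b3 a3b1 a3b2 a3b3.
have far x y : adj x b1 -> adj x y -> adj y a1 -> d a1 x = 2.
  move=> xb xy ya; have := dT y a1 x; have := dT x a1 b1.
  by rewrite (d_adj xb) (dC a1 y) (d_adj ya) (dC y x) (d_adj xy); lia.
have far' x y : adj x a1 -> adj x y -> adj y b1 -> d b1 x = 2.
  move=> xa xy yb; have := dT y b1 x; have := dT x b1 a1.
  by rewrite (dC b1 a1) (d_adj xa) (dC b1 y) (d_adj yb) (dC y x) (d_adj xy); lia.
have a12 : d a1 a2 = 2 by apply: (far _ b2) => //; apply: adjC.
have a13 : d a1 a3 = 2 by apply: (far _ b2) => //; apply: adjC.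
have b12 : d b1 b2 = 2 by apply: (far' _ a2) => //; apply: adjC.
have b13 : d b1 b3 = 2 by apply: (far' _ a2) => //; apply: adjC.
have nb23 : ~ adj b2 b3.
  move=> b; case: (K4 b (adjC a1b2) (adjC a2b2) (adjC a1b3) (adjC a2b3)).
    by move=> e; move: a12; rewrite e dxx.
  by move=> /d_adj; rewrite a12.
have na23 : ~ adj a2 a3.
  move=> a; case: (K4 a a2b1 a2b2 a3b1 a3b2).
    by move=> e; move: b12; rewrite e dxx.
  by move=> /d_adj; rewrite b12.
have a23 := d2 a2b1 (adjC a3b1) na na23.
have b23 := d2 (adjC a1b2) a1b3 nb nb23.
apply: (HG.2.2.2.2); exists a1, a2, a3, b1, b2, b3.
by do !split.
Qed.

(* For neighbours [u], [v] of [x]: they lie on a common line (maximal clique)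
   through [x], or [x, u], [x, v] are sides of a square. *)
Definition perp (x u v : V) : Prop :=
  [\/ u = v, adj u v | exists c, [/\ c <> x, adj c u & adj c v]].

Lemma perpC x u v : perp x u v -> perp x v u.
Proof.
by case=> [->|/adjC uv|[c [n cu cv]]]; [constructor 1|constructor 2|constructor 3; exists c].
Qed.

Lemma perp_lower o x u v k : adj u x -> adj v x ->
  d o u = k -> d o v = k -> d o x = k.+1 -> perp x u v.
Proof.
move=> ux vx Eu Ev Ex; case: (classic (u = v)) => [|n]; first by constructor 1.
case: k Eu Ev Ex => [|k] Eu Ev Ex; first by case: n; apply: d0_inj Eu Ev.
case: (QC ux vx n Eu Ev Ex) => c [cu cv Ec].
by constructor 3; exists c; split=> // e; subst; lia.
Qed.

(** In the main case the triangle condition, seen from [z], applies to the edge [c u] and yields the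
    fourth vertex of a square on [u], [x], [z]. *)
Lemma perp_line x u v z : adj u x -> adj v x -> adj z x -> adj z v ->
  perp x u v -> perp x u z.
Proof.
move=> ux vx zx zv; case=> [->|uv|[c [ncx cu cv]]]; first by constructor 2; apply: adjC.
  by case: (K4 vx (adjC uv) (adjC zv) (adjC ux) (adjC zx)); [constructor 1|constructor 2].
case: (classic (u = v)) => [->|nuv]; first by constructor 2; apply: adjC.
case: (classic (adj u v)) => [uv|nauv].
  by case: (K4 vx (adjC uv) (adjC zv) (adjC ux) (adjC zx)); [constructor 1|constructor 2].
have ncx' : ~ adj c x by move=> cx; case: (K4 cx cu cv (adjC ux) (adjC vx)).
case: (eq_adj_d2 ux (adjC zx)) => [->|uz|Euz]; [by constructor 1|by constructor 2|].
case: (eq_adj_d2 cv (adjC zv)) => [e|cz|Ecz]; first by subst.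
  by case: (K4 (adjC zv) (adjC cv) vx (adjC cz) zx) => [//|cx].
case: (@TC z c u 1 cu) => [||e [ec eu Ee]]; [by rewrite dC|by rewrite dC|].
constructor 3; exists e; split=> // [ex|]; last by apply: adjC; apply: d1.
by subst; apply: ncx'; apply: adjC.
Qed.

(** * Gated sets *)

Definition nbr_closed (S : V -> Prop) : Prop :=
  forall u v z, S u -> S v -> u <> v -> adj z u -> adj z v -> S z.

Lemma gated_convex S u v x : gated adj S -> S u -> S v -> d u x + d x v = d u v -> S x.
Proof.
move=> gS Su Sv E; case: (gS x) => g [Sg Hg].
have := Hg _ Su; have := Hg _ Sv; rewrite /interval => Ev Eu.
have := dT g u v; have := dC u x; have := dC g u => E1 E2 T.
suff -> : x = g by [].
by apply: d0; lia.
Qed.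

Lemma gated_closed S : gated adj S -> nbr_closed S.
Proof.
move=> gS u v z Su Sv n zu zv; case: (gS z) => g [Sg Hg].
have := Hg _ Su; have := Hg _ Sv; rewrite /interval (d_adj zu) (d_adj zv) => Ev Eu.
case E: (d z g) => [|k]; first by move/d0: E => ->.
case: n.
have <- : g = u by apply: d0; lia.
by apply: d0; lia.
Qed.

Lemma gate_uniq S x g h : is_gate adj S x g -> is_gate adj S x h -> g = h.
Proof.
move=> [Sg Hg] [Sh Hh]; have := Hg _ Sh; have := Hh _ Sg; rewrite /interval => E1 E2.
by apply: d0; rewrite (dC h g) in E1; lia.
Qed.

Lemma gate_self S x : S x -> is_gate adj S x x.
Proof. by move=> Sx; split=> // y _; rewrite /interval dxx. Qed.

Lemma gate_adj S x s : gated adj S -> ~ S x -> S s -> adj x s -> is_gate adj S x s.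
Proof.
move=> gS nSx Ss xs; case: (gS x) => g Hg; have [Sg Hg'] := Hg.
have := Hg' _ Ss; rewrite /interval (d_adj xs) => E.
suff <- : g = s by [].
apply: d0; case E1: (d x g) E => [|k]; last lia.
by move/d0: E1 nSx => ->.
Qed.

Lemma gate_lip S u v u' v' : adj u v -> is_gate adj S u u' -> is_gate adj S v v' ->
  d u' v' <= 1.
Proof.
move=> uv [Su Hu] [Sv Hv]; have := Hu _ Sv; have := Hv _ Su; rewrite /interval (dC v' u').
have := dT v u v'; have := dT u v u'; rewrite (dC v u) (d_adj uv); lia.
Qed.

Section Descent.
Variables (S : V -> Prop) (x : V).

(** Greedy descent towards [x] within [S], ending at a local minimum of the distance to [x]; this
    end will be the gate of [x]. *)
Inductive descend : V -> V -> Prop :=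
| descend_min y : S y -> (forall z, S z -> adj z y -> d x y <= d x z) -> descend y y
| descend_step y z g : S y -> adj z y -> d x y = (d x z).+1 -> descend z g -> descend y g.

Lemma descend_gate y g : descend y g -> S g /\ d x y = d x g + d g y.
Proof.
elim=> [z Sz _|{}y z {}g Sy zy E _ [Sg IH]]; first by rewrite dxx addn0.
split=> //; have := lip g zy; have := dT g x y; lia.
Qed.

Lemma descend_in y g : descend y g -> S y.
Proof. by case. Qed.

Hypothesis clS : nbr_closed S.

(* Newman's lemma: steps towards [x] inside [S] are confluent by the quadrangle
   condition, since [S] contains the vertex that closes the quadrangle. *)
Lemma descend_nf n y : S y -> d x y <= n -> exists g, forall h, descend y h <-> h = g.
Proof.
elim: n y => [|n IH] y Sy le_n.
  exists y => h; split=> [D|->]; last by apply: descend_min => // *; lia.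
  by case: D Sy le_n => // a b c _ _ e _ _; lia.
case: (classic (exists z, [/\ S z, adj z y & d x y = (d x z).+1])) => [[z [Sz zy E]]|no].
  have [|g Hg] := IH z Sz; first lia.
  exists g => h; split=> [D|->]; last by apply: (descend_step Sy zy E); apply/Hg.
  case: D Sy zy E le_n => [a Sa amin _ za E _|a b c Sa ba Eb D _ za E le_n].
    by have := amin _ Sz za; lia.
  case: (classic (b = z)) => [e|n_bz]; first by subst; apply/Hg.
  case Ek : (d x z) => [|k].
    by case: n_bz; apply: (@d0_inj x); lia.
  have [|||c' [c'b c'z Ec]] := @QC x b z a k ba za n_bz; [lia|lia|lia|].
  have Sb := descend_in D.
  have Sc : S c' by apply: clS Sb Sz _ c'b c'z.
  have [|gc Hc] := IH c' Sc; first lia.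
  have [|gb Hb] := IH b Sb; first lia.
  have Dc : descend c' gc by apply/Hc.
  have Db : descend b gc by apply: (descend_step Sb c'b) => //; lia.
  have Dz : descend z gc by apply: (descend_step Sz c'z) => //; lia.
  by rewrite (Hb c).1 // -(Hb gc).1 // (Hg gc).1.
have ymin z : S z -> adj z y -> d x y <= d x z.
  move=> Sz zy; case: (leqP (d x y) (d x z)) => // lt; case: no.
  by exists z; split=> //; have := lip x zy; lia.
exists y => h; split=> [D|->]; last by apply: descend_min.
by case: D ymin => // a b c _ ba E /descend_in Sb /(_ b Sb ba); lia.
Qed.

(** Adjacent vertices of [S] have the same normal form: one is a step below the other, or the
    triangle condition gives a common lower neighbour, which lies in [S]. *)
Lemma descend_walk u v n g : walk (induced adj S) u v n -> descend u g -> descend v g.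
Proof.
elim=> // {}u w {}v {}n [Su [Sw uw]] _ IH Du; apply: IH.
have [gu Hu] := descend_nf Su (leqnn _).
have [gw Hw] := descend_nf Sw (leqnn _).
have Dw : descend w gw by apply/Hw.
have Du' : descend u gu by apply/Hu.
suff e : gu = gw by rewrite (Hu g).1 // e.
have [l1 l2] := lip x uw.
case: (ltngtP (d x u) (d x w)) => [lt|lt|E].
- by apply/Hw; apply: (descend_step Sw uw) => //; lia.
- by symmetry; apply/Hu; apply: (descend_step Su (adjC uw)) => //; lia.
case Ek : (d x u) => [|k].
  by case: (@adjN u); rewrite {2}(_ : u = w) // -(d0 Ek); apply: d0; rewrite -E.
have [|c [cu cw Ec]] := TC uw Ek; first by rewrite -E.
have Sc : S c by apply: clS Su Sw _ cu cw => e; case: (@adjN u); rewrite {2}e.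
have [gc Hc] := descend_nf Sc (leqnn _).
have Dc : descend c gc by apply/Hc.
have D1 : descend u gc by apply: (descend_step Su cu) => //; lia.
have D2 : descend w gc by apply: (descend_step Sw cw) => //; lia.
by rewrite -((Hu gc).1 D1) -((Hw gc).1 D2).
Qed.

End Descent.

(** Local-to-global criterion: all vertices of the connected set [S] descend to the same [g], and
    descents are geodesic towards [x]. *)
Lemma gated_intro S : (exists x, S x) -> nbr_closed S ->
  (forall u v, S u -> S v -> exists n, walk (induced adj S) u v n) -> gated adj S.
Proof.
move=> [b Sb] cl cn x.
have [g Hg] := @descend_nf S x cl _ b Sb (leqnn _).
have Db : descend S x b g by apply/Hg.
exists g; split=> [|y Sy]; first exact: (descend_gate Db).1.
have [n W] := cn _ _ Sb Sy.
by have [_] := descend_gate (descend_walk cl W Db); rewrite /interval; lia.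
Qed.

Lemma convex_walk (S : V -> Prop) u v :
  (forall a b x, S a -> S b -> d a x + d x b = d a b -> S x) ->
  S u -> S v -> walk (induced adj S) u v (d u v).
Proof.
move=> cx; move E: (d u v) => n; elim: n u E => [|n IH] u E Su Sv.
  by rewrite (d0 E); exact: walk0.
have [w [uw Ew]] := step E.
have Sw : S w by apply: (cx u v) => //; rewrite (d_adj uw) Ew E.
by apply: (@walkS _ _ _ w) => //; apply: IH.
Qed.

(** Convexity of the members makes the intersection connected, so [gated_intro] applies. *)
Lemma gated_bigcap (P : (V -> Prop) -> Prop) a :
  (forall X, P X -> gated adj X /\ X a) -> gated adj (fun z => forall X, P X -> X z).
Proof.
move=> HP; apply: gated_intro; first by exists a => X /HP [].
  by move=> u v z Hu Hv n zu zv X PX; apply: (gated_closed (HP X PX).1 (Hu X PX) (Hv X PX) n).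
move=> u v Hu Hv; exists (d u v); apply: (convex_walk _ Hu Hv) => x y z Hx Hy E X PX.
exact: (gated_convex (HP X PX).1 (Hx X PX) (Hy X PX)).
Qed.

Lemma gated_hull_gated x y : gated adj (gated_hull adj x y).
Proof.
move=> w; have [|g [G1 G2]] := @gated_bigcap (fun X => [/\ gated adj X, X x & X y]) x _ w.
  by move=> X [].
exists g; split=> [X g1 g2 g3|u Hu]; first exact: G1.
by apply: G2 => X [g1 g2 g3]; apply: Hu.
Qed.

Lemma hull_l x y : gated_hull adj x y x. Proof. by []. Qed.
Lemma hull_r x y : gated_hull adj x y y. Proof. by []. Qed.

Lemma gatedI A B a : gated adj A -> gated adj B -> A a -> B a ->
  gated adj (fun z => A z /\ B z).
Proof.
move=> gA gB Aa Ba w.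
have [|g [G1 G2]] := @gated_bigcap (fun X => X = A \/ X = B) a _ w; first by move=> X [] ->.
exists g; split=> [|u [Au Bu]]; first by split; apply: G1; [left|right].
by apply: G2 => X [] ->.
Qed.

Lemma gated1 a : gated adj (fun z => z = a).
Proof. by move=> x; exists a; split=> // y ->; rewrite /interval dxx addn0. Qed.

Lemma gdist_gated X u v : gated adj X -> X u -> X v -> gdist (induced adj X) u v = d u v.
Proof.
move=> gX Xu Xv.
have W := convex_walk (fun a b x => @gated_convex X a b x gX) Xu Xv.
have [W' min] := gdist_spec (ex_intro _ _ W).
have sub a b : induced adj X a b -> adj a b by case=> _ [].
have := min _ W; have := gdist_min conn (walk_le_map sub W'); lia.
Qed.

(** Working form of [thick_set] for gated sets, where induced distances are those of the graph. Two
    common neighbours suffice: they are not adjacent, as K_4^- is excluded. *)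
Definition thick (X : V -> Prop) : Prop :=
  forall u v, X u -> X v -> d u v = 2 ->
    exists a b, [/\ a <> b, adj a u, adj a v & adj b u /\ adj b v].

Lemma boolean_gated_thick X : boolean_gated adj X <-> gated adj X /\ thick X.
Proof.
split=> [[gX H]|[gX H]]; split=> //.
  move=> u v Xu Xv.
  move=> E; have := H u v Xu Xv; rewrite gdist_gated // => /(_ E).
  move=> [a [b [c [e [Xa [Xb [Xc [Xe]]]]]]]].
  rewrite /interval !gdist_gated // E.
  move=> [Ia [Ib [Ic [Ie [nac [nbe [ab [bc [ce [ea [ac be]]]]]]]]]]].
  have mid t : d u t + d t v = 2 -> [\/ t = u, t = v | adj t u /\ adj t v].
    case E1 : (d u t) => [|[|[|k]]] E2; last lia.
    - by constructor 1; rewrite (d0 E1).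
    - by constructor 3; split; [apply: adjC|]; apply: d1; lia.
    by constructor 2; apply: d0; lia.
  have nab : a <> b by move=> e'; subst; case: (adjN ab).
  have nbc : b <> c by move=> e'; subst; case: (adjN bc).
  have nce : c <> e by move=> e'; subst; case: (adjN ce).
  have nea : e <> a by move=> e'; subst; case: (adjN ea).
  have pick s t : s <> t -> adj s u /\ adj s v -> adj t u /\ adj t v ->
      exists a b, [/\ a <> b, adj a u, adj a v & adj b u /\ adj b v].
    by move=> n [? ?] ?; exists s, t.
  (* Three of the four distinct vertices cannot all be in {u, v}, so two of them are common
     neighbours. *)
  case: (mid _ Ia) => Ha; case: (mid _ Ib) => Hb; case: (mid _ Ic) => Hc;
    case: (mid _ Ie) => He; first
      [ by subst | exact: (pick _ _ nab Ha Hb) | exact: (pick _ _ nac Ha Hc)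
      | exact: (pick _ _ (nesym nea) Ha He) | exact: (pick _ _ nbc Hb Hc)
      | exact: (pick _ _ nbe Hb He) | exact: (pick _ _ nce Hc He)].
rewrite /thick_set => u v Xu Xv; rewrite gdist_gated // => E; have [nuv nauv] := d2_neq E.
have [a [b [nab au av [bu bv]]]] := H u v Xu Xv E.
have Xa := gated_closed gX Xu Xv nuv au av; have Xb := gated_closed gX Xu Xv nuv bu bv.
have nadj : ~ adj a b by move=> ab; case: (K4 ab au av bu bv).
exists u, a, v, b; rewrite /interval !gdist_gated // !dxx E (dC u a) (dC u b).
rewrite (d_adj au) (d_adj av) (d_adj bu) (d_adj bv).
by do !split=> //; apply: adjC.
Qed.

Lemma thick_sub (A B : V -> Prop) : (forall z, A z -> B z) -> thick B -> thick A.
Proof. by move=> AB tB u v /AB Bu /AB Bv; exact: tB. Qed.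

Lemma thick_perp B x u v : thick B -> B u -> B v -> adj u x -> adj v x -> perp x u v.
Proof.
move=> tB Bu Bv ux vx; case: (eq_adj_d2 ux (adjC vx)) => [|uv|E].
- by constructor 1.
- by constructor 2.
have [a [b [n au av [bu bv]]]] := tB _ _ Bu Bv E.
constructor 3; case: (classic (a = x)) => [e|]; last by exists a.
by exists b; split=> // e'; apply: n; rewrite e e'.
Qed.

(** * Extending a thick gated set by a neighbour *)

Hint Immediate adjC : core.

Section Extension.
Variable S : V -> Prop.
Hypotheses (gS : gated adj S) (tS : thick S).

Definition over z s := [/\ ~ S z, S s & adj z s].

(** Since [s] is the only neighbour of [z] in [S], only the square case of [perp] can occur here:
    the edge [z s] can be moved along every edge of [S] at [s]. *)
Definition over_perp z s := over z s /\ forall t, S t -> adj t s -> perp s z t.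

(* For [u], [v] over [s]: the line through [s] and [u] and the one through [s] and [v]
   coincide, or they span a quad that meets [S] in a line. *)
Definition parallel_at s u v :=
  [\/ u = v, adj u v | exists c t, [/\ adj c u, adj c v, over c t & adj t s]].

Lemma over_gate z s : over z s -> is_gate adj S z s.
Proof. by move=> [nz Ss zs]; apply: gate_adj. Qed.

Lemma over_d z s t : over z s -> S t -> d z t = (d s t).+1.
Proof.
move=> zs St; have [_ /(_ t St)] := over_gate zs.
by have [_ _ /d_adj E] := zs; rewrite /interval E; lia.
Qed.

Lemma over_uniq z s t : over z s -> S t -> adj z t -> t = s.
Proof. by move=> zs St /d_adj; rewrite (over_d zs St) => -[] /d0. Qed.

Lemma over_out u s z : over u s -> adj z u -> z <> s -> ~ S z.
Proof. by move=> us zu n Sz; apply: n; apply: over_uniq us Sz _; auto. Qed.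

Lemma over_lip u v s t : over u s -> over v t -> adj u v -> s = t \/ adj s t.
Proof.
move=> us vt uv; have := gate_lip uv (over_gate us) (over_gate vt).
by case E: (d s t) => [|[|]] // _; [left; apply: d0|right; apply: d1].
Qed.

(** The gate of [c] lies between [c] and both [s] and [t], which are at distance at most 2; a gate
    at distance 2 would equal both. *)
Lemma over_between c u v s t : adj c u -> adj c v -> over u s -> over v t -> s <> t ->
  ~ S c -> exists g, over c g.
Proof.
move=> cu cv us vt n nc; have [g Hg] := gS c; have [Sg Ig] := Hg.
have [_ Ss _] := us; have [_ St _] := vt.
have := Ig _ Ss; have := Ig _ St; rewrite /interval => Et Es.
have [l1 _] := lip s cu; have [l2 _] := lip t cv.
have us1 := over_d us Ss; have vt1 := over_d vt St; rewrite dxx in us1; rewrite dxx in vt1.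
have d1' := dC s u; have d2' := dC t v; have d3 := dC s c; have d4 := dC t c.
exists g; split=> //; apply: d1.
case E: (d c g) => [|[|k]] //; first by rewrite (d0 E) in nc.
have e1 : g = s by apply: d0; lia.
have e2 : g = t by apply: d0; lia.
by case: n; rewrite -e1 e2.
Qed.

(** Cube completion: seen from [c1], the vertices [c2] and [b] have distance 2 and [t2] distance 3,
    so the quadrangle condition applies at [t2]. *)
Lemma over_square v b c1 c2 t1 t2 : over c1 t1 -> over c2 t2 ->
  adj c1 v -> adj c2 v -> S b -> adj b t1 -> adj b t2 -> d t1 t2 = 2 ->
  exists e, [/\ adj e c1, adj e c2 & over e b].
Proof.
move=> o1 o2 c1v c2v Sb bt1 bt2 E12; have [n1 St1 a1] := o1; have [n2 St2 a2] := o2.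
have E1 := over_d o1 St2; have E2 := over_d o1 Sb.
rewrite E12 in E1; rewrite dC in E2; rewrite (dC t1 b) (d_adj bt1) dC in E2.
have E3 : d c1 c2 = 2.
  by have [] := lip c1 a2; have := dT v c1 c2; rewrite (d_adj c1v) (dC v c2) (d_adj c2v); lia.
have [|e [ec2 eb /d1 ec1]] := QC a2 bt2 _ E3 E2 E1; first by move=> e; subst.
exists e; split; auto; split=> // Se.
by move: E1; rewrite -(over_uniq o2 Se) ?(d_adj ec1) //; auto.
Qed.

(** If [t] is at distance 2 from [s], thickness gives a second common neighbour [r]. The squares on
    [v s u], [v s r] and [u s r] are three faces of a cube at [s], and [over_square] finds the
    vertex over [t]. *)
Lemma over_perp_transport v s z u : over_perp v s -> S u -> adj u s ->
  adj z u -> adj z v -> ~ S z -> over_perp z u.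
Proof.
move=> [vs Hv] Su us zu zv nz; have [nv Ss av] := vs.
have zu' : over z u by [].
split=> // t St tu.
have psz : perp u s z by constructor 3; exists v; split; auto => e; subst.
case: (eq_adj_d2 tu us) => [e|ts|Ets]; first by subst; apply: perpC.
  by apply: (perp_line _ _ _ _ (perpC psz)); auto.
case: (thick_perp tS St Ss tu (adjC us)) => [e|ts|[r [nru rt rs]]].
- by move: Ets; rewrite e dxx.
- by move: Ets; rewrite (d_adj ts).
have Sr : S r by apply: (gated_closed gS St Ss _ rt rs) => e; move: Ets; rewrite e dxx.
have Eur : d u r = 2.
  apply: (d2 us) => // [|e|ur]; [by auto|by subst|].
  by case: (K4 ur us (adjC tu) rs rt) => [e|/adjC /d_adj]; [move: Ets; rewrite e dxx|rewrite Ets].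
have [e|vr|[q [nqs qv qr]]] := Hv r Sr rs; first by subst.
  by have e := over_uniq vs Sr vr; subst; case: (adjN rs).
have nq : ~ S q by apply: over_out vs qv nqs.
have qr' : over q r by [].
have [e [ez eq er]] := over_square zu' qr' zv qv St tu (adjC rt) Eur.
constructor 3; exists e; split; auto; last by case: er.
by move=> e'; subst; case: er.
Qed.

Lemma over_perp_line u s v : over_perp u s -> adj v u -> adj v s -> over_perp v s.
Proof.
move=> [us Hu] vu vs; have [nu Ss us'] := us.
split; first by split=> //; apply: over_out us vu _ => e; subst; case: (adjN vs).
move=> t St ts; apply: perpC; apply: (perp_line _ _ _ _ (perpC (Hu t St ts))); auto.
Qed.

Lemma over_perp_step v s u : over_perp v s -> S u -> adj u s ->
  exists z, [/\ adj z v, adj z u & over_perp z u].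
Proof.
move=> Hv Su us; have [vs Hv'] := Hv; have [nv Ss av] := vs.
have [e|vu|[z [n zv zu]]] := Hv' u Su us; first by subst.
  by move: (over_uniq vs Su vu) us => -> /adjN.
exists z; split=> //; apply: (over_perp_transport Hv Su us zu zv).
exact: over_out vs zv n.
Qed.

Lemma parallelC s u v : parallel_at s u v -> parallel_at s v u.
Proof.
by case=> [->|/adjC uv|[c [t [? ? ? ?]]]];
  [constructor 1|constructor 2|constructor 3; exists c, t].
Qed.

(** Adjacent vertices have equal or adjacent gates; if [t = s], the absence of K_4^- puts [u] and
    [v] on one line. *)
Lemma parallel_intro s u v c t : over u s -> over v s -> adj c u -> adj c v -> over c t ->
  parallel_at s u v.
Proof.
move=> us vs cu cv ct; have [_ _ us'] := us; have [_ _ vs'] := vs; have [_ _ cs] := ct.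
case: (over_lip ct us cu) => [e|ts]; last by constructor 3; exists c, t.
by subst; case: (K4 cs cu cv (adjC us') (adjC vs')); [constructor 1|constructor 2].
Qed.

Lemma parallel_adj s u v r : over u s -> over v s -> over r s -> adj u v ->
  parallel_at s v r -> parallel_at s u r.
Proof.
move=> us vs rs uv; have [_ Ss us'] := us; have [_ _ vs'] := vs; have [_ _ rs'] := rs.
case=> [<-|vr|[c [t [cv cr ct ts]]]]; first by constructor 2.
  by case: (K4 vs' (adjC uv) vr (adjC us') (adjC rs')); [constructor 1|constructor 2].
case: (eq_adj_d2 us' (adjC rs')) => [|?|Eur]; [by constructor 1|by constructor 2|].
case: (eq_adj_d2 cv (adjC uv)) => [e|cu|Ecu].
- have [_ St ct'] := ct; rewrite e in ct'.
  by move: ts; rewrite (over_uniq us St ct') => /adjN.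
- exact: parallel_intro us rs cu cr ct.
(* [e] replaces [c] as common neighbour of [u] and [r]; lying between [r] and [c], it is again at
   distance 1 from [S]. *)
have [||e [ec er /d1 eu]] := @TC u c r 1 cr; [by rewrite dC|by []|].
have [nc St ct'] := ct.
have ns : e <> s.
  by move=> e'; subst; have e2 := over_uniq ct Ss (adjC ec); subst; case: (adjN ts).
have [|g eg] := over_between ec er ct rs _ (over_out rs er ns).
  by move=> e'; subst; case: (adjN ts).
exact: (parallel_intro us rs (adjC eu) er eg).
Qed.

(* Veblen's axiom in the geometry of lines through [s], first for two quads that
   meet [S] in the same line ... *)
Lemma parallel_trans_same s u v r c1 c2 t : over u s -> over v s -> over r s ->
  over c1 t -> over c2 t -> adj t s -> adj c1 u -> adj c1 v -> adj c2 v -> adj c2 r ->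
  parallel_at s u r.
Proof.
move=> us vs rs o1 o2 ts c1u c1v c2v c2r.
have [nu Ss us'] := us; have [nv _ vs'] := vs; have [nr _ rs'] := rs.
have [n1 St c1t] := o1; have [n2 _ c2t] := o2.
have nts : t <> s by move=> e; subst; case: (adjN ts).
case: (classic (c1 = c2)) => [e|n12]; first by subst; exact: parallel_intro us rs c1u c2r o2.
have n12' : ~ adj c1 c2.
  move=> c12; case: (K4 c12 c1v c1t c2v c2t) => [e|vt]; first by subst.
  by apply: nts; apply: over_uniq vs St vt.
have Ec1s := over_d o1 Ss; rewrite (d_adj ts) in Ec1s.
case: (classic (c1 = r)) => [e|ncr].
  by subst; case: nts; symmetry; apply: (over_uniq o1 Ss).
case: (classic (adj c1 r)) => [c1r|nc1r]; first exact: parallel_intro us rs c1u c1r o1.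
have : d c1 r <= 3.
  by have := dT t c1 r; have [] := lip t c2r; rewrite (d_adj c1t) (dC t c2) (d_adj c2t); lia.
case Er : (d c1 r) => [|[|[|[|k]]]] // _.
- by case: ncr; apply: d0.
- by case: nc1r; apply: d1.
- have [y [yr ys /d1 yc1]] := TC rs' Er Ec1s.
  have oy : over y s by split; auto; apply: over_out rs yr _ => e; subst; case: (adjN ys).
  apply: parallelC; apply: (parallel_adj rs oy us); first by auto.
  exact: (parallel_intro oy us yc1 c1u o1).
(* The vertices [c1], [c2], [s] against [r], [v], [t] would form K_{3,3} without the edge [c1 r]. *)
case: (@K33 c1 c2 s r v t Er); auto.
- by move=> e; subst.
- by move=> e; subst.
Qed.

(* ... then for quads that meet [S] in the lines through [t1] and [t2]. *)
Lemma parallel_trans s u v r : over u s -> over v s -> over r s ->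
  parallel_at s u v -> parallel_at s v r -> parallel_at s u r.
Proof.
move=> us vs rs; have [nu Ss us'] := us; have [nv _ vs'] := vs; have [nr _ rs'] := rs.
case=> [->//|uv|[c1 [t1 [c1u c1v o1 ts1]]]]; first exact: parallel_adj.
case=> [<-|vr|[c2 [t2 [c2v c2r o2 ts2]]]].
- by constructor 3; exists c1, t1.
- apply: parallelC; apply: (parallel_adj rs vs us); first by auto.
  exact: (parallel_intro vs us c1v c1u o1).
have [n1 St1 c1t] := o1; have [n2 St2 c2t] := o2.
have nts1 : t1 <> s by move=> e; subst; case: (adjN ts1).
have nts2 : t2 <> s by move=> e; subst; case: (adjN ts2).
case: (eq_adj_d2 ts1 (adjC ts2)) => [e|t12|E12].
- by subst; apply: (parallel_trans_same us vs rs o1 o2).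
- have E1 := over_d vs St1; have E2 := over_d o2 St1.
  rewrite dC (dC s t1) (d_adj ts1) in E1; rewrite dC (dC t2) (d_adj t12) in E2.
  (* [e] moves the second quad over [t1], which reduces to [parallel_trans_same], if need be after
     replacing [r] by [y] on the same line. *)
  have [e [ev ec2 /d1 et1]] := TC (adjC c2v) E1 E2.
  have oe : over e t1.
    split; auto; apply: over_out vs ev _ => e'; subst.
    by case: nts2; symmetry; apply: (over_uniq o2 Ss); auto.
  case: (classic (adj e r)) => [er|ner]; first exact: (parallel_trans_same us vs rs o1 oe).
  have Ees := over_d oe Ss; rewrite (d_adj ts1) in Ees.
  have Eer : d e r = 2.
    apply: (d2 ec2 c2r) => // e'; subst.
    by case: nts1; apply: (over_uniq rs St1 (adjC et1)).
  have [y [yr ys /d1 ye]] := TC rs' Eer Ees.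
  have oy : over y s by split; auto; apply: over_out rs yr _ => e'; subst; case: (adjN ys).
  apply: parallelC; apply: (parallel_adj rs oy us); first by auto.
  apply: parallelC; apply: (parallel_trans_same us vs oy o1 oe); auto.
case: (thick_perp tS St1 St2 ts1 ts2) => [e|ts|[b [nbs bt1 bt2]]].
- by move: E12; rewrite e dxx.
- by move: E12; rewrite (d_adj ts).
have nt12 : t1 <> t2 by move=> e; move: E12; rewrite e dxx.
have Sb : S b by apply: (gated_closed gS St1 St2 nt12).
have Esb : d s b = 2.
  apply: (d2 (adjC ts1)) => [|e|sb]; [by auto|by subst|].
  by case: (K4 sb (adjC ts1) (adjC ts2) bt1 bt2) => // /d_adj; rewrite E12.
(* Seen from the cube vertex [e] over [b], both [u] and [r] lie one level below [s]; the quadrangle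
   condition yields their common neighbour [y]. *)
have [e [ec1 ec2 oe]] := over_square o1 o2 c1v c2v Sb bt1 bt2 E12.
have Ees := over_d oe Ss; rewrite dC in Esb; rewrite Esb in Ees.
have Eeu : d e u = 2.
  by have := dT c1 e u; have [] := lip e us'; rewrite Ees (d_adj ec1) (d_adj c1u); lia.
have Eer : d e r = 2.
  by have := dT c2 e r; have [] := lip e rs'; rewrite Ees (d_adj ec2) (d_adj c2r); lia.
case: (classic (u = r)) => [|nur]; first by constructor 1.
have [y [yu yr /d1 ye]] := QC us' rs' nur Eeu Eer Ees.
have ny : ~ S y.
  by apply: over_out us yu _ => e'; subst; move: Ees; rewrite dC (d_adj (adjC ye)).
have [|g yg] := over_between yu (adjC ye) us oe _ ny.
  by move=> e'; subst; move: Esb; rewrite dxx.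
exact: (parallel_intro us rs yu yr yg).
Qed.

(** For a quad with trace [a] in [S], the cases are that [a] equals [t], is adjacent to it, or is at
    distance 2. Each time vertices over [t] are chained by [parallel_trans]; in the last case a cube
    over the square [s a b t] supplies them. *)
Lemma parallel_transport s u v t u' v' : over_perp u s -> over_perp v s ->
  parallel_at s u v -> S t -> adj t s -> over u' t -> over v' t -> adj u' u -> adj v' v ->
  parallel_at t u' v'.
Proof.
move=> Hu Hv uv St ts ou ov u'u v'v; have [us _] := Hu; have [vs _] := Hv.
have [nu Ss us'] := us; have [nv _ vs'] := vs.
have [nu' _ u't] := ou; have [nv' _ v't] := ov.
have nts : t <> s by move=> e; subst; case: (adjN ts).
have nu's : ~ adj u' s by move=> /(over_uniq ou Ss) e; subst.
have Etu := over_d us St; have Etv := over_d vs St.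
rewrite dC (dC s) (d_adj ts) in Etu; rewrite dC (dC s) (d_adj ts) in Etv.
case: uv => [e|uv|[c [a [cu cv oa as_]]]].
- by subst; apply: (parallel_intro ou ov (adjC u'u) (adjC v'v) vs).
- case: (classic (u' = v)) => [e|nu'v].
    by subst; case: nu's.
  have nau'v : ~ adj u' v.
    by move=> a; case: (K4 uv (adjC u'u) us' (adjC a) vs') => [e|] //; subst.
  have Evu' : d v u' = 2 by rewrite dC; apply: (d2 u'u uv).
  have [|e [eu' et /d1 ev]] := TC u't Evu'; first by rewrite dC.
  have oe : over e t.
    split; auto; apply: over_out vs (adjC ev) _ => e'; subst.
    by case: nu's; auto.
  apply: (parallel_adj ou oe ov); first by auto.
  exact: (parallel_intro oe ov ev (adjC v'v) vs).
have [nc Sa ca] := oa.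
have nas : a <> s by move=> e; subst; case: (adjN as_).
have ncs : ~ adj c s by move=> /(over_uniq oa Ss) e; subst.
case: (eq_adj_d2 as_ (adjC ts)) => [e|at_|Eat].
- subst; apply: (parallel_trans ou oa ov).
    exact: (parallel_intro ou oa (adjC u'u) (adjC cu) us).
  exact: (parallel_intro oa ov (adjC cv) (adjC v'v) vs).
- have Etc := over_d oa St; rewrite dC (d_adj at_) in Etc.
  have [e [eu ec /d1 et]] := TC (adjC cu) Etu Etc.
  have [f [fv fc /d1 ft]] := TC (adjC cv) Etv Etc.
  have oe : over e t.
    by split; auto; apply: over_out us eu _ => e'; subst; case: ncs; auto.
  have of_ : over f t.
    by split; auto; apply: over_out vs fv _ => e'; subst; case: ncs; auto.
  apply: (parallel_trans ou oe ov).
    exact: (parallel_intro ou oe (adjC u'u) (adjC eu) us).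
  apply: (parallel_trans oe of_ ov).
    exact: (parallel_intro oe of_ (adjC ec) (adjC fc) oa).
  exact: (parallel_intro of_ ov (adjC fv) (adjC v'v) vs).
case: (thick_perp tS Sa St as_ ts) => [e|at_|[b [nbs ba bt]]].
- by move: Eat; rewrite e dxx.
- by move: Eat; rewrite (d_adj at_).
have nat_ : a <> t by move=> e; move: Eat; rewrite e dxx.
have Sb : S b by apply: (gated_closed gS Sa St nat_).
have Ebs : d b s = 2.
  apply: (d2 ba as_ nbs) => bs.
  by case: (K4 bs ba bt (adjC as_) (adjC ts)) => // /d_adj; rewrite Eat.
have [e [ec eu' oe]] := over_square oa ou cu u'u Sb ba bt Eat.
have Ees := over_d oe Ss; rewrite Ebs in Ees.
have Eev : d e v = 2.
  by have := dT c e v; have [] := lip e vs'; rewrite Ees (d_adj ec) (d_adj cv); lia.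
have Eet : d e t = 2 by rewrite (over_d oe St) (d_adj bt).
have nvt : v <> t by move=> e'; subst.
have [w [wv wt /d1 we]] := QC vs' ts nvt Eev Eet Ees.
have ow : over w t.
  by split; auto; apply: over_out vs wv _ => e'; subst; move: Ees; rewrite (d_adj we).
apply: (parallel_trans ou ow ov).
  exact: (parallel_intro ou ow eu' we oe).
exact: (parallel_intro ow ov (adjC wv) (adjC v'v) vs).
Qed.

(** * The thick gated set spanned by [S] and one neighbour *)

Section OnePoint.
Variables w x : V.
Hypothesis Hw : over_perp w x.

Let Sx : S x. Proof. by case: Hw => -[]. Qed.
Let ow : over w x. Proof. by case: Hw. Qed.

(* [c] is obtained from [w] by parallel transport along a geodesic of [S] from [x] to [s]. *)
Definition translate c s := over_perp c s /\ d w c = d x s.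

Lemma translate_up c s t : translate c s -> S t -> adj t s -> d x t = (d x s).+1 ->
  exists c', translate c' t /\ adj c' c.
Proof.
move=> [Hc Ec] St ts Et; have [z [zc zt Hz]] := over_perp_step Hc St ts.
exists z; split=> //; split=> //.
have [l1 _] := lip w zc; have [_ l2] := lip w zt.
by have := over_d ow St; lia.
Qed.

Lemma translate_ex s : S s -> exists c, translate c s.
Proof.
move E: (d s x) => n; elim: n s E => [|n IH] s E Ss.
  by exists w; rewrite (d0 E); split=> //; rewrite !dxx.
have [r [sr Er]] := step E.
have Sr : S r by apply: (gated_convex gS Ss Sx); rewrite (d_adj sr) Er E.
have [c Hc] := IH r Er Sr.
have [|c' [Hc' _]] := translate_up Hc Ss sr; first by rewrite dC E dC Er.
by exists c'.
Qed.

(** When [s] and [t] are equally far from [x], they have a common neighbour [r] nearer to [x]: lift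
    from [r] to [s], then the triangle condition seen from [t] completes the prism. *)
Lemma translate_step s t : S s -> S t -> adj s t ->
  exists c c', [/\ translate c s, translate c' t & adj c c'].
Proof.
move=> Ss St st; have [l1 l2] := lip x st.
case: (ltngtP (d x s) (d x t)) => [lt|lt|E].
- have [c Hc] := translate_ex Ss.
  have [|c' [Hc' a]] := translate_up Hc St (adjC st); first lia.
  by exists c, c'; split; auto.
- have [c Hc] := translate_ex St.
  have [|c' [Hc' a]] := translate_up Hc Ss st; first lia.
  by exists c', c; split; auto.
case Ek : (d x s) => [|k].
  by case: (@adjN s); rewrite {2}(_ : s = t) // -(d0 Ek); apply: d0; rewrite -E.
have Etk : d x t = k.+1 by lia.
have [r [rs rt Er]] := TC st Ek Etk.
have nst : s <> t by move=> e; subst; case: (adjN st).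
have Sr : S r by apply: (gated_closed gS Ss St nst).
have [c Hc] := translate_ex Sr.
have [|c1 [Hc1 c1c]] := translate_up Hc Ss (adjC rs); first lia.
have [[oc _] Ec] := Hc; have [[oc1 _] Ec1] := Hc1.
have Etc := over_d oc St; have Etc1 := over_d oc1 St.
rewrite (d_adj rt) dC in Etc; rewrite (d_adj st) dC in Etc1.
have [e [ec ec1 /d1 et]] := TC (adjC c1c) Etc Etc1.
have ne : ~ S e.
  apply: over_out oc ec _ => e'; subst.
  by have e2 := over_uniq oc1 Sr (adjC ec1); subst; case: (adjN rs).
have He : over_perp e t by apply: (over_perp_transport (proj1 Hc) St); auto.
exists c1, e; split; auto; split=> //.
have [m1 _] := lip w ec; have [m2 m3] := lip w et.
by have := over_d ow St; lia.
Qed.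

(** Seen from [w], both lie one level below [s], so they have a lower common neighbour [r]. If the
    gate of [r] were at distance 2 it would be [s], and [r] would be too far from [x]. *)
Lemma translate_parallel c c' s : translate c s -> translate c' s -> parallel_at s c c'.
Proof.
move=> [[oc _] Ec] [[oc' _] Ec']; have [nc Ss cs] := oc; have [nc' _ c's] := oc'.
case Ek : (d x s) => [|k].
  by constructor 1; transitivity w; [symmetry|]; apply: d0; lia.
case: (classic (c = c')) => [|ncc]; first by constructor 1.
have Ews := over_d ow Ss; rewrite Ek in Ews; rewrite Ek in Ec; rewrite Ek in Ec'.
have [r [rc rc' Er]] := QC cs c's ncc Ec Ec' Ews.
have nr : ~ S r by apply: over_out oc rc _ => e; subst; lia.
suff [g og] : exists g, over r g by apply: (parallel_intro oc oc' rc rc' og).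
have [g [Sg Hg]] := gS r; exists g; split=> //; apply: d1.
have Egs := Hg _ Ss; have Egx := Hg _ Sx; rewrite /interval in Egs Egx.
have Ewg := over_d ow Sg.
have T1 := dT c r s; rewrite (d_adj rc) (d_adj cs) in T1.
have T2 := dT w r x; rewrite (d_adj (let: And3 _ _ a := ow in a)) in T2.
have C1 := dC r w; have C2 := dC g x; have T3 := dT r w g.
case E: (d r g) => [|[|[|j]]] //; [by rewrite (d0 E) in nr| |lia].
have e : g = s by apply: d0; lia.
by subst; lia.
Qed.

Inductive comp : V -> V -> Prop :=
| comp_base : comp w x
| comp_step u s z t : comp u s -> adj z u -> over_perp z t -> comp z t.

Lemma comp_over z s : comp z s -> over_perp z s.
Proof. by case. Qed.

(** Translates of [w] serve as reference points: parallelism to them is carried along paths of the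
    component, even when a path returns to the same gate. *)
Lemma comp_translate z s : comp z s -> exists c, translate c s /\ parallel_at s z c.
Proof.
elim=> [|u {}s {}z t Hu [c [Hc uc]] zu Hz].
  by exists w; split; [split=> //; rewrite !dxx|constructor 1].
have Hu' := comp_over Hu; have [ou _] := Hu'; have [oz _] := Hz; have [oc _] := proj1 Hc.
have [nz St _] := oz; have [_ Ss _] := ou.
case: (over_lip ou oz (adjC zu)) => [e|st].
  by subst; exists c; split=> //; apply: (parallel_adj oz ou oc).
have [c1 [c2 [Hc1 Hc2 c12]]] := translate_step Ss St st.
exists c2; split=> //.
apply: (parallel_transport Hu' (proj1 Hc1) _ St (adjC st) oz (proj1 (proj1 Hc2)) zu (adjC c12)).
by apply: (parallel_trans ou oc (proj1 (proj1 Hc1)) uc); apply: translate_parallel.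
Qed.

Lemma comp_parallel u v s : comp u s -> comp v s -> parallel_at s u v.
Proof.
move=> Hu Hv; have [ou _] := comp_over Hu; have [ov _] := comp_over Hv.
have [c [Hc uc]] := comp_translate Hu; have [c' [Hc' vc]] := comp_translate Hv.
have [oc _] := proj1 Hc; have [oc' _] := proj1 Hc'.
apply: (parallel_trans ou oc ov uc); apply: (parallel_trans oc oc' ov).
  exact: translate_parallel.
exact: parallelC.
Qed.

Lemma comp_nbr v s u z : comp v s -> S u -> adj z u -> adj z v -> ~ S z -> comp z u.
Proof.
move=> Hv Su zu zv nz; have Hv' := comp_over Hv.
have oz : over z u by [].
apply: (comp_step Hv zv).
case: (over_lip (proj1 Hv') oz (adjC zv)) => [e|su].
  by subst; apply: (over_perp_line Hv').
by apply: (over_perp_transport Hv' Su _ zu zv nz); auto.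
Qed.

Definition span z := S z \/ exists s, comp z s.

(** The critical [z] is adjacent to two component vertices but to no vertex of [S]. Both then have
    the same gate [s] and are parallel there; their quad together with [z] gives a K_4^- or
    K_{3,3}^-. *)
Lemma span_closed : nbr_closed span.
Proof.
move=> u v z Mu Mv nuv zu zv.
case: (classic (S z)) => [|nz]; first by left.
case: Mu Mv => [Su|[s Hu]] [Sv|[t Hv]].
- by left; apply: (gated_closed gS Su Sv nuv).
- by right; exists u; apply: (comp_nbr Hv).
- by right; exists v; apply: (comp_nbr Hu).
have [ou _] := comp_over Hu; have [ov _] := comp_over Hv.
have [nu Ss us] := ou; have [nv St vt] := ov.
have [g [Sg Hg]] := gS z.
case: (classic (adj z g)) => [zg|nzg]; first by right; exists g; apply: (comp_nbr Hu).
have far r y : S r -> adj y r -> adj z y -> g = r.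
  move=> Sr yr zy; have := Hg _ Sr; have := dT y z r; rewrite /interval (d_adj zy) (d_adj yr).
  case E: (d z g) => [|[|k]]; [by rewrite (d0 E) in nz|by move/d1: E|].
  by move=> T E2; apply: d0; lia.
have e1 := far _ _ Ss us zu; have e2 := far _ _ St vt zv; subst g t.
case: (comp_parallel Hu Hv) => [//|uv|[c [a [cu cv oc as_]]]].
  by case: (K4 uv (adjC zu) us (adjC zv) vt) => [e|//]; subst.
have [nc Sa ca] := oc.
have Eza : d z a = 3.
  have := Hg _ Sa; rewrite /interval (dC s) (d_adj as_).
  have := dT u z s; rewrite (d_adj zu) (d_adj us).
  case E: (d z s) => [|[|[|k]]]; [by rewrite (d0 E) in nz|by move/d1: E|lia|lia].
by case: (@K33 z s c a u v Eza); auto => e; subst.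
Qed.

Lemma span_gated : gated adj span.
Proof.
apply: gated_intro span_closed _; first by exists x; left.
have to_S u : span u -> exists s, S s /\ exists n, walk (induced adj span) u s n.
  case=> [Su|[s Hu]]; first by exists u; split=> //; exists 0; apply: walk0.
  have [[_ Ss us] _] := comp_over Hu; exists s; split=> //; exists 1.
  by apply: walk1; split; [right; exists s|split=> //; left].
have symi a b : induced adj span a b -> induced adj span b a.
  by case=> Ma [Mb ab]; split=> //; split; auto.
move=> u v /to_S [s [Ss [m W1]]] /to_S [t [St [n W2]]].
have W := convex_walk (fun a b z => @gated_convex S a b z gS) Ss St.
have subi a b : induced adj S a b -> induced adj span a b.
  by case=> Sa [Sb ab]; split; [left|split=> //; left].
exists (m + (d s t + n)); apply: (walk_cat W1); apply: (walk_cat (walk_le_map subi W)).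
exact: walkC symi _ _ _ W2.
Qed.

(** Local form of thickness. At [m] in [S] it combines thickness of [S], [over_perp] and
    parallelism; at a component vertex it lifts lines and squares of [S] through the gates of [y]
    and [z]. *)
Lemma span_perp m y z : span m -> span y -> span z -> adj y m -> adj z m -> perp m y z.
Proof.
case=> [Sm|[s Hm]].
  case=> [Sy|[s Hy]] [Sz|[t Hz]] ym zm.
  - exact: thick_perp tS Sy Sz ym zm.
  - have [oz Pz] := comp_over Hz; have e := over_uniq oz Sm zm; subst.
    by apply: perpC; apply: Pz.
  - have [oy Py] := comp_over Hy; have e := over_uniq oy Sm ym; subst.
    exact: Py.
  have [oy _] := comp_over Hy; have [oz _] := comp_over Hz.
  have e1 := over_uniq oy Sm ym; have e2 := over_uniq oz Sm zm; subst.
  case: (comp_parallel Hy Hz) => [|?|[c [a [cy cz oc _]]]]; [by constructor 1|by constructor 2|].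
  by constructor 3; exists c; split=> // e; subst; case: oc.
have [om _] := comp_over Hm; have [nm Ss ms] := om.
have inS q : S q -> adj q m -> q = s by move=> Sq qm; apply: (over_uniq om Sq); auto.
have mixed z' t : comp z' t -> adj z' m -> perp m s z'.
  move=> Hz zm; have [oz _] := comp_over Hz; have [nz St zt] := oz.
  case: (over_lip om oz (adjC zm)) => [e|st]; first by subst; constructor 2; auto.
  by constructor 3; exists t; split; auto => e; subst.
case=> [Sy|[t1 Hy]] [Sz|[t2 Hz]] ym zm.
- by rewrite (inS y) // (inS z) //; constructor 1.
- by rewrite (inS y) //; apply: (mixed _ t2).
- by rewrite (inS z) //; apply: perpC; apply: (mixed _ t1).
have [oy _] := comp_over Hy; have [oz _] := comp_over Hz.
have [ny St1 yt1] := oy; have [nz St2 zt2] := oz.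
case: (over_lip om oy (adjC ym)) => [e1|st1].
  subst t1; apply: perpC; apply: (perp_line zm (adjC ms) ym yt1).
  by apply: perpC; apply: (mixed _ t2).
case: (over_lip om oz (adjC zm)) => [e2|st2].
  by subst t2; apply: (perp_line ym (adjC ms) zm zt2); apply: perpC; apply: (mixed _ t1).
case: (eq_adj_d2 (adjC st1) st2) => [e|t12|E12].
- by subst; constructor 3; exists t2; split; auto => e; subst.
- have E1 := over_d om St1; have E2 := over_d oz St1.
  rewrite dC (d_adj st1) in E1; rewrite dC (dC t2) (d_adj t12) in E2.
  have [e [em ez /d1 et1]] := TC (adjC zm) E1 E2.
  have ye : perp m y e by constructor 3; exists t1; split; auto => e'; subst.
  by apply: (perp_line ym em zm (adjC ez) ye).
case: (thick_perp tS St1 St2 (adjC st1) (adjC st2)) => [e|a|[b [nbs bt1 bt2]]].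
- by move: E12; rewrite e dxx.
- by move: E12; rewrite (d_adj a).
have Sb : S b by apply: (gated_closed gS St1 St2 _ bt1 bt2) => e; move: E12; rewrite e dxx.
have [e [ey ez oe]] := over_square oy oz ym zm Sb bt1 bt2 E12.
constructor 3; exists e; split=> // e'; subst.
by apply: nbs; have [_ _ mb] := oe; apply: (over_uniq om Sb mb).
Qed.

Lemma span_thick : thick span.
Proof.
move=> y z My Mz E; have [nyz nayz] := d2_neq E; have [m [ym mz]] := d2_mid E.
have Mm := span_closed My Mz nyz (adjC ym) mz.
case: (span_perp Mm My Mz ym (adjC mz)) => [//|//|[c [ncm cy cz]]].
by exists c, m; split; auto.
Qed.

End OnePoint.
End Extension.

Lemma thick_extension S w x : gated adj S -> thick S -> S x -> ~ S w -> adj w x ->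
  (forall t, S t -> adj t x -> perp x w t) ->
  exists M, [/\ gated adj M, thick M, forall z, S z -> M z, M w &
    forall z, M z -> S z \/ exists2 s, S s & adj z s].
Proof.
move=> gS tS Sx nw wx Hp; have Hw : over_perp S w x by [].
exists (span S w x); split.
- exact: span_gated.
- exact: span_thick.
- by left.
- by right; exists x; apply: comp_base.
move=> z [|[s /comp_over Hz]]; first by left.
by right; exists s; case: (Hz Hw) => -[].
Qed.

(** * Pairs of vertices in a common thick gated set *)

Definition thick_pair x y := exists B, [/\ gated adj B, thick B, B x & B y].

Lemma thick_pairC x y : thick_pair x y -> thick_pair y x.
Proof. by case=> B [*]; exists B. Qed.

Lemma hullC x y z : gated_hull adj x y z -> gated_hull adj y x z.
Proof. by move=> H X *; apply: H. Qed.

Lemma hull_thick x y : thick_pair x y -> thick (gated_hull adj x y).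
Proof. by case=> B [gB tB Bx By]; apply: thick_sub tB => z; apply. Qed.

(** Along a geodesic from [y] to [x], each extension raises the largest distance to [y] by at most
    1, so a gated set with the bound exists and contains the hull. *)
Lemma hull_ecc x y z : thick_pair x y -> gated_hull adj x y z -> d y z <= d y x.
Proof.
case=> B [gB tB Bx By].
suff [S [gS _ Sx Sy HS]] : exists S, [/\ gated adj S, forall u, S u -> B u, S x, S y &
    forall u, S u -> d y u <= d y x] by move=> H; apply: HS; apply: H.
move E: (d x y) => n; elim: n x E Bx {z} => [|n IH] x E Bx.
  exists (fun u => u = y); rewrite (d0 E); split=> //; [exact: gated1|by move=> u ->|].
  by move=> u ->.
have [r [xr Er]] := step E.
have Br : B r by apply: (gated_convex gB Bx By); rewrite (d_adj xr) Er E.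
have [S [gS SB Sr Sy HS]] := IH r Er Br.
have Eyx := dC y x; have Eyr := dC y r.
case: (classic (S x)) => [Sx|nSx].
  by exists S; split=> // u /HS; lia.
have [|M [gM _ SM Mx HM]] := thick_extension gS (thick_sub SB tB) Sr nSx xr.
  by move=> t St tr; apply: (thick_perp tB Bx (SB _ St) xr tr).
(* Intersecting with [B] preserves the inclusion in [B], from which the next extension draws its
   squares. *)
exists (fun u => M u /\ B u); split; [|by move=> u []|by []|by split; auto|].
  by apply: (gatedI gM gB Mx Bx).
move=> u [/HM [/HS Hs|[s /HS Hs us]] _]; first lia.
by have [] := lip y us; lia.
Qed.

Definition below o x y := adj y x /\ d o x = (d o y).+1.

(** By [hull_ecc], a neighbour of [x] in the hull that is not nearer to [o] is equally far, and then
    the triangle condition puts it on a line with a nearer one. *)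
Lemma perp_hull w x o z : thick_pair x o -> adj w x -> (forall y, below o x y -> perp x w y) ->
  gated_hull adj x o z -> adj z x -> perp x w z.
Proof.
move=> Txo wx Hb Hz zx; have [l1 l2] := lip o zx.
have le := hull_ecc Txo Hz.
case: (leqP (d o x) (d o z)) => [ge|lt]; last by apply: Hb; split=> //; lia.
case Ek : (d o x) => [|k].
  by case: (@adjN x); rewrite {1}(_ : x = z) //; apply: (@d0_inj o); lia.
have [|y [yx yz Ey]] := TC (adjC zx) Ek; first lia.
apply: (perp_line wx yx zx (adjC yz)).
by apply: Hb; split=> //; lia.
Qed.

(** Working form of the extension principle: only the neighbours of [x] towards [o] have to be
    tested. *)
Lemma thick_grow w x o : thick_pair x o -> adj w x -> (forall y, below o x y -> perp x w y) ->
  exists M, [/\ gated adj M, thick M, M w, M x & M o].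
Proof.
move=> Txo wx Hb; have gS := gated_hull_gated x o; have tS := hull_thick Txo.
case: (classic (gated_hull adj x o w)) => [Sw|nSw].
  by exists (gated_hull adj x o); split.
have [|M [gM tM SM Mw _]] := thick_extension gS tS (hull_l (y := o)) nSw wx.
  by move=> t St tx; apply: perp_hull St tx.
by exists M; split=> //; apply: SM.
Qed.

(** * Isometric cubes in thick gated sets *)

Lemma thick_translate (S B : V -> Prop) y y' s : gated adj S -> gated adj B -> thick B ->
  (forall z, S z -> B z) -> B y -> over S y y' -> S s ->
  exists c, [/\ B c, over S c s & d c y <= d s y'].
Proof.
move=> gS gB tB SB By oy; have [ny Sy' _] := oy.
move E: (d s y') => n; elim: n s E => [|n IH] s E Ss.
  by exists y; rewrite dxx (d0 E).
have [r [sr Er]] := step E.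
have Sr : S r by apply: (gated_convex gS Ss Sy'); rewrite (d_adj sr) Er E.
have [c [Bc oc le]] := IH r Er Sr; have [nc _ cr] := oc.
have [e|cs|[c' [n' c'c c's]]] := thick_perp tB Bc (SB _ Ss) cr sr; first by subst.
  by have e := over_uniq gS oc Ss cs; subst; case: (adjN sr).
have n'' : c <> s by move=> e; subst.
exists c'; split; first exact: (gated_closed gB Bc (SB _ Ss) n'').
  by split=> //; apply: (over_out gS oc c'c).
by have := dT c c' y; rewrite (d_adj c'c); lia.
Qed.

(* Two opposite facets of the cube to be built span gated sets [S], [S'] that are
   translates of each other. *)
Lemma over_interval (S S' : V -> Prop) x y c y' z g : gated adj S -> gated adj S' ->
  over S c x -> over S y y' -> over S' x c -> over S' y' y ->
  d c y = d x y' -> S z -> d x z + d z y' = d x y' -> is_gate adj S' z g ->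
  over S g z /\ over S' z g.
Proof.
move=> gS gS' oc oy ox oy' Ecy Sz Ez [S'g Hg].
have [_ _ _] := oc; have [_ S'c _] := ox; have [_ S'y _] := oy'.
have G1 := Hg _ S'c; have G2 := Hg _ S'y; rewrite /interval in G1 G2.
have E1 := over_d gS oc Sz; have E2 := over_d gS oy Sz.
have C1 := dC z c; have C2 := dC z y; have C3 := dC y' z; have C4 := dC g c.
have T1 := dT g c y.
have nz : ~ S' z by move=> S'z; have := over_d gS' ox S'z; lia.
have Ezg : d z g = 1.
  case E: (d z g) => [|[|k]]; [by rewrite (d0 E) in nz|by []|lia].
have zg := d1 Ezg; split; last by split.
split; auto=> Sg.
by have := over_d gS oc Sg; have := over_d gS' ox S'g; lia.
Qed.

(** Hamming distance on bit lists, where adding a dimension is consing a bit. *)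
Definition ham (a b : seq bool) := count (fun p => p.1 != p.2) (zip a b).

(** Induction on the dimension: a cube from [x] to a neighbour [y'] of [y] is one facet, and its
    image under the gate map to the hull of [c] and [y] is the opposite one. *)
Lemma thick_cube n x y : thick_pair x y -> d x y = n -> exists F : seq bool -> V,
  [/\ forall a b, size a = n -> size b = n -> d (F a) (F b) = ham a b,
      F (nseq n false) = x & F (nseq n true) = y].
Proof.
case=> B [gB tB]; elim: n x y => [|n IH] x y Bx By E.
  exists (fun=> x); split=> //; last exact: d0.
  by move=> a b /size0nil -> /size0nil ->; rewrite dxx.
have [y' [yy' Ey']] : exists y', adj y y' /\ d y' x = n by apply: step; rewrite dC.
have By' : B y' by apply: (gated_convex gB By Bx); rewrite (d_adj yy') Ey' (dC y x) E.
have Exy' : d x y' = n by rewrite dC.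
set S := gated_hull adj x y'; have gS : gated adj S := gated_hull_gated x y'.
have SB z : S z -> B z by apply.
have Txy' : thick_pair x y' by exists B.
have oy : over S y y'.
  by split=> // /hullC /(hull_ecc (thick_pairC Txy')); lia.
have [c [Bc oc le]] := thick_translate gS gB tB SB By oy (hull_l (x := x) (y := y')).
have [nc _ cx] := oc.
have Ecy : d c y = n by have [] := lip y cx; rewrite (dC y c) (dC y x); lia.
set S' := gated_hull adj c y; have gS' : gated adj S' := gated_hull_gated c y.
have Tcy : thick_pair c y by exists B.
have Ecy' := over_d gS oc (hull_r (x := x) (y := y')).
have ox : over S' x c.
  split; [|exact: hull_l|by auto].
  by move=> /(hull_ecc Tcy); have := dC y x; have := dC y c; lia.
have oy' : over S' y' y.
  split; [|exact: hull_r|by auto].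
  by move=> /hullC /(hull_ecc (thick_pairC Tcy)); lia.
have [f [Hf fx fy']] := IH x y' Bx By' Exy'.
have If a : size a = n -> d x (f a) + d (f a) y' = d x y'.
  move=> sa; rewrite -fx -fy' !Hf ?size_nseq // /ham.
  elim: (n) a sa {f Hf fx fy'} => [|m IHm] [|b a] //= [] /IHm IHa.
  by case: b => /=; rewrite add0n -?addnA ?IHa // addnCA IHa.
have Sf a : size a = n -> S (f a).
  by move=> /If E'; apply: (gated_convex gS _ _ E').
pose G z := epsilon (inhabits z) (is_gate adj S' z).
have HG' z : is_gate adj S' z (G z) by apply: epsilon_spec; apply: gS'.
have Eg : d c y = d x y' by lia.
have HO a : size a = n -> over S (G (f a)) (f a) /\ over S' (f a) (G (f a)).
  by move=> sa; apply: (over_interval gS gS' oc oy ox oy' Eg (Sf _ sa) (If _ sa) (HG' _)).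
(* The first bit selects the facet; the empty list gets the default [x], all relevant lists having
   length [n.+1]. *)
exists (fun a => if a is b :: a' then if b then G (f a') else f a' else x); split.
- move=> [|[] a] [|[] b] //= [sa] [sb]; rewrite /ham /= -?/(ham a b) ?add0n ?add1n -Hf //.
  (* The distance from [G (f a)] to [f b] is one more than the distance in either facet, so the gate
     map is isometric on the cube. *)
  + have [oa o'a] := HO _ sa; have [ob o'b] := HO _ sb.
    have [_ Sb _] := o'b.
    have := over_d gS oa (Sf _ sb); have := over_d gS' o'a Sb.
    rewrite (dC (G (f a)) (f b)).
    have [_ Sa _] := o'a; have := over_d gS' o'b Sa.
    by rewrite (dC (G (f b)) (G (f a))); lia.
  + by have [oa _] := HO _ sa; rewrite (over_d gS oa (Sf _ sb)).
  by have [ob _] := HO _ sb; rewrite dC (over_d gS ob (Sf _ sa)) dC.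
- exact: fx.
rewrite /= fy'; apply: (gate_uniq (HG' _)).
exact: over_gate.
Qed.

(** * Boolean pairs *)

Section IntervalCube.
Variables x y : V.
Notation I := (interval adj x y).

Lemma interval_down u w : I u -> adj u w -> d x u = (d x w).+1 -> I w.
Proof.
rewrite /interval => Iu uw E; have [] := lip y uw.
by have := dT w x y; have := dC y u; have := dC y w; lia.
Qed.

Lemma interval_walk u : I u -> walk (induced adj I) u x (d u x).
Proof.
move E: (d u x) => n; elim: n u E => [|n IH] u E Iu; first by rewrite (d0 E); apply: walk0.
have [w [uw Ew]] := step E.
have Iw : I w by apply: (interval_down Iu uw); rewrite dC E dC Ew.
by apply: (walkS (w := w)) => //; apply: IH.
Qed.

Lemma interval_conn u v : I u -> I v -> exists n, walk (induced adj I) u v n.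
Proof.
move=> /interval_walk W1 /interval_walk W2; exists (d u x + d v x).
apply: walk_cat W1 _; apply: walkC W2.
by move=> a b [Ia [Ib ab]]; split=> //; split; auto.
Qed.

(** An edge within one level would have common neighbours one step towards [x] and one step towards
    [y]; these coincide or are adjacent, which shortens the way from [x] to [y]. *)
Lemma interval_graded s t : I s -> I t -> adj s t -> d x s <> d x t.
Proof.
rewrite /interval => Is It st E; have Cs := dC s y; have Ct := dC t y.
have nst : s <> t by move=> e; subst; case: (adjN st).
case Es : (d x s) => [|k]; first by case: nst; rewrite -(d0 Es); apply: d0; lia.
case Ey : (d y s) => [|l]; first by case: nst; rewrite -(d0 Ey); apply: d0; lia.
have [|c [cs ct Ec]] := TC st Es; first lia.
have [|e [es et Ee]] := TC st Ey; first lia.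
have T := dT e x y; have C := dC e y.
case: (K4 st (adjC cs) (adjC es) (adjC ct) (adjC et)) => [ce|ce]; first by subst; lia.
by have [] := lip x ce; lia.
Qed.

(** A common neighbour of [u], [v] towards [y] and one of [s], [t] towards [x] would be at distance
    3 and complete a K_{3,3}^-. *)
Lemma interval_square s t u v k : I s -> I u -> I v -> u <> v -> s <> t ->
  adj s u -> adj s v -> adj t u -> adj t v ->
  d x s = k -> d x t = k -> d x u = k.+1 -> d x v = k.+1 -> False.
Proof.
rewrite /interval => Is Iu Iv nuv nst su sv tu tv Es Et Eu Ev.
have Cs := dC s y; have Cu := dC u y; have Cv := dC v y.
case Ey : (d y u) => [|l]; first by case: nuv; rewrite -(d0 Ey); apply: d0; lia.
have [|||z [zu zv Ez]] := @QC y u v s l (adjC su) (adjC sv) nuv; [lia|lia|lia|].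
have T := dT z x y; have C := dC z y; have [L _] := lip x zu.
case: k Es Et Eu Ev => [|k] Es Et Eu Ev; first by case: nst; rewrite -(d0 Es) -(d0 Et).
have [b [bs bt Eb]] := QC su tu nst Es Et Eu.
have T2 := dT b x z; have [L2 _] := lip z bs; have [L3 _] := lip z su.
have E3 : d z b = 3.
  by have := dC z b; have := d_adj zu; lia.
by apply: (K33 E3 nst nuv); auto.
Qed.

Section Cube.
Variables (n : nat) (g : {set 'I_n} -> V).
Hypotheses (gI : forall A, I (g A)) (g_inj : injective g).
Hypothesis g_adj : forall (A : {set 'I_n}) i, i \notin A -> adj (g A) (g (i |: A)).
Hypothesis g_min : forall A, d x (g set0) <= d x (g A).

(* The cube need not contain [x] a priori; ranks are counted from its vertex nearest
   to [x], and then a dimension count forces that vertex to be [x]. *)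
Lemma cube_rank A : d x (g A) = d x (g set0) + #|A|.
Proof.
move E: #|A| => m; elim/ltn_ind: m A E => -[|m] IH A E.
  by rewrite (cards0_eq E) addn0.
have /card_gt0P [i iA] : 0 < #|A| by rewrite E.
set C := A :\ i; have niC : i \notin C by rewrite !inE eqxx.
have defA : i |: C = A by rewrite setD1K.
have Cm : #|C| = m by have := cardsD1 i A; rewrite -/C iA E => -[].
have ECm := IH _ (ltnSn m) _ Cm.
have CA := g_adj niC; rewrite defA in CA.
have [l1 l2] := lip x CA; have ne := interval_graded (gI _) (gI _) CA.
case: m E IH Cm ECm => [|m] E IH Cm ECm; first by have := g_min A; lia.
suff : d x (g A) <> d x (g set0) + m by lia.
(* Otherwise [A] drops to the level of [D], two elements smaller, and with [C] and [i |: D] they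
   form the square excluded by [interval_square]. *)
move=> EA; have /card_gt0P [j jC] : 0 < #|C| by rewrite Cm.
set D := C :\ j; have njD : j \notin D by rewrite !inE eqxx.
have defC : j |: D = C by rewrite setD1K.
have nij : i != j by apply: contraNneq niC => ->.
have niD : i \notin D by apply: contra niC => /setD1P [].
have Dm : #|D| = m by have := cardsD1 j C; rewrite -/D jC Cm => -[].
have Bm : #|i |: D| = m.+1 by rewrite cardsU1 niD Dm.
have njB : j \notin i |: D by rewrite !inE eq_sym (negbTE nij) eqxx.
have DC := g_adj njD; rewrite defC in DC.
have BA := g_adj njB; rewrite setUCA defC defA in BA.
apply: (@interval_square (g D) (g A) (g C) (g (i |: D)) (d x (g set0) + m)) => //.
- by move=> /g_inj e; move: niC; rewrite e !inE eqxx.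
- by move=> /g_inj e; move: niD; rewrite e iA.
- exact: g_adj.
- by auto.
- by auto.
- exact: (IH m _ D Dm).
- by rewrite ECm; lia.
- by rewrite (IH m.+1 _ _ Bm); lia.
Qed.

Hypothesis g0 : g set0 = x.

Lemma cube_le (A B : {set 'I_n}) : A \subset B -> d (g A) (g B) <= #|B| - #|A|.
Proof.
move E: (#|B| - #|A|) => m; elim: m A E => [|m IH] A E sAB.
  have /eqP -> : A == B by rewrite eqEcard sAB; lia.
  by rewrite dxx.
have [i iB niA] : exists2 i, i \in B & i \notin A.
  by apply/subsetPn; apply/negP => sBA; have := subset_leq_card sBA; lia.
have iAB : i |: A \subset B by rewrite subUset sub1set iB.
have E2 : #|B| - #|i |: A| = m by rewrite cardsU1 niA; lia.
have := dT (g (i |: A)) (g A) (g B); rewrite (d_adj (g_adj niA)).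
by have := IH _ E2 iAB; lia.
Qed.

Lemma cube_d A : d x (g A) = #|A|.
Proof. by rewrite cube_rank g0 dxx. Qed.

(** Remove [i] from [A] to get [C]. Both [g [set i]] and the neighbours of [x] towards [g C] are
    nearer to [g A] than [x], so the hull of [x] and [g C] extends to [g [set i]]; closure under
    common neighbours then fills in the cube up to [g A]. *)
Lemma cube_thick_pair A : thick_pair x (g A).
Proof.
move E: #|A| => m; elim: m A E => [|m IH] A E.
  rewrite (cards0_eq E) g0; exists (fun z => z = x); split=> //; first exact: gated1.
  by move=> u v -> ->; rewrite dxx.
have /card_gt0P [i iA] : 0 < #|A| by rewrite E.
set C := A :\ i; have niC : i \notin C by rewrite !inE eqxx.
have defA : i |: C = A by rewrite setD1K.
have Cm : #|C| = m by have := cardsD1 i A; rewrite -/C iA E => -[].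
have CA := g_adj niC; rewrite defA in CA.
have wx : adj (g [set i]) x.
  by apply: adjC; rewrite -g0 -(setU0 [set i]); apply: g_adj; rewrite inE.
have EAx : d (g A) x = m.+1 by rewrite dC cube_d.
have [M [gM tM Mw Mx MC]] : exists M, [/\ gated adj M, thick M, M (g [set i]), M x & M (g C)].
  apply: thick_grow => //; first exact: IH.
  move=> z [zx Ez]; apply: (perp_lower wx zx _ _ EAx).
    have := @cube_le [set i] A; rewrite sub1set iA cards1 E dC => /(_ isT).
    by have [] := lip (g A) wx; lia.
  have := cube_d C; rewrite dC Ez Cm; have [] := lip (g A) zx.
  have := dT (g C) (g A) z; rewrite (dC _ (g C)) (d_adj CA); lia.
have inM (D : {set 'I_n}) : D \subset C -> M (g D).
  move=> sDC; apply: (gated_convex gM Mx MC).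
  have := cube_le sDC; have := dT (g D) x (g C); rewrite !cube_d.
  have := subset_leq_card sDC; lia.
suff H (D : {set 'I_n}) : D \subset C -> M (g (i |: D)).
  by exists M; split=> //; rewrite -defA; apply: H.
move E2: #|D| => k; elim: k D E2 => [|k IHk] D E2 sDC.
  by rewrite (cards0_eq E2) setU0.
have /card_gt0P [j jD] : 0 < #|D| by rewrite E2.
have sD' : D :\ j \subset C by apply: subset_trans sDC; apply: subsetDl.
have niD : i \notin D by apply: contra niC; apply: (subsetP sDC).
have Dk : #|D :\ j| = k by have := cardsD1 j D; rewrite jD E2 => -[].
have njD : j \notin i |: D :\ j.
  by rewrite !inE eqxx /= orbF; apply: contraNneq niD => <-.
have a1 := g_adj njD; rewrite setUCA setD1K // in a1.
apply: (gated_closed gM (IHk _ Dk sD') (inM _ sDC)); last 2 first.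
- exact: adjC.
- by apply: adjC; apply: g_adj.
by move=> /g_inj e; move: niD; rewrite -e !inE eqxx.
Qed.

End Cube.

Lemma boolean_pair_thick : boolean_pair adj x y -> thick_pair x y.
Proof.
case=> f [fI Hf]; set n := d x y in f fI Hf.
have W a b := gdist_spec (interval_conn (fI a) (fI b)).
(* Bit functions at Hamming distance 0 are only pointwise equal; their images agree because they are
   at distance 0. *)
have f_ext a b : hamming a b = 0 -> f a = f b.
  by have [+ _] := W a b; rewrite Hf => + E; rewrite E => w; inversion w.
have f_inj a b : f a = f b -> hamming a b = 0.
  move=> e; have [_ H] := W a b; move: H; rewrite Hf e => /(_ 0 (walk0 _ _)); lia.
have f_adj a b : hamming a b = 1 -> adj (f a) (f b).
  have [+ _] := W a b; rewrite Hf => + E; rewrite E => w.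
  inversion w as [|? u ? ? H1 H2]; subst; inversion H2; subst.
  by case: H1 => _ [].
have [r [[a Ea] min_a]] := ex_least (ex_intro (fun r => exists a, d x (f a) = r) _
  (ex_intro _ (fun=> false) (erefl _))).
(* Recentre the cube so that the empty set is sent to its vertex nearest to [x]. *)
pose g (A : {set 'I_n}) := f (fun i => (i \in A) (+) a i).
have hamg A B : hamming (fun i => (i \in A) (+) a i) (fun i => (i \in B) (+) a i) =
    #|[pred i | (i \in A) != (i \in B)]|.
  by apply: eq_card => i; rewrite !inE; case: (i \in A) (i \in B) (a i) => [] [] [].
have gI A : I (g A) by apply: fI.
have g_inj : injective g.
  move=> A B /f_inj; rewrite hamg => /card0_eq H; apply/setP => i.
  by move: (H i); rewrite !inE => /negbFE /eqP.
have g_adj (A : {set 'I_n}) i : i \notin A -> adj (g A) (g (i |: A)).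
  move=> niA; apply: f_adj; rewrite hamg -(card1 i); apply: eq_card => j.
  rewrite !inE; case: (eqVneq j i) => [->|_]; first by rewrite (negbTE niA).
  by rewrite eqxx.
have g_min A : d x (g set0) <= d x (g A).
  suff -> : g set0 = f a by rewrite Ea; apply: min_a; exists (fun i => (i \in A) (+) a i).
  by apply: f_ext; apply: eq_card0 => i; rewrite !inE eqxx.
have rk := cube_rank gI g_inj g_adj g_min.
(* The top vertex has level [n] plus that of the bottom, but levels in the interval are at most [n];
   so the bottom is [x] and the top [y]. *)
have := rk setT; rewrite cardsT card_ord => ET.
have := gI setT; rewrite /interval -/n => IT.
have g0 : g set0 = x by symmetry; apply: d0; lia.
suff <- : g setT = y by apply: (cube_thick_pair gI g_inj g_adj g_min g0).
by apply: d0; lia.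
Qed.

Lemma ham_step a b k : size a = size b -> ham a b = k.+1 ->
  exists a', [/\ size a' = size a, ham a a' = 1 & ham a' b = k].
Proof.
have ham0 s : ham s s = 0 by elim: s => //= t s; rewrite /ham /= eqxx.
elim: a b k => [|s a IH] [|t b] k //= [sab]; rewrite /ham /= -!/(ham _ _).
case: (eqVneq s t) => [->|nst] /= E; last first.
  exists (t :: a); rewrite /ham /= eqxx -!/(ham _ _) ham0 nst; split=> //.
  by case: E.
have [|a' [sa' E1 E2]] := IH b k sab; first lia.
by exists (t :: a'); rewrite /ham /= eqxx -!/(ham _ _) sa' E1 E2.
Qed.

(** Shortest bit-flip paths stay in the interval, so the cube of [thick_cube] is also isometric in
    the subgraph that the interval induces. *)
Lemma thick_boolean_pair : thick_pair x y -> boolean_pair adj x y.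
Proof.
move=> Txy; have [F [HF F0 F1]] := thick_cube Txy (erefl (d x y)).
set n := d x y in HF F0 F1.
have FI a : size a = n -> I (F a).
  move=> sa; rewrite /interval -{1}F0 -{1}F1 !HF ?size_nseq // -/n /ham.
  elim: (n) a sa {HF F0 F1} => [|m IHm] [|b a] //= [] /IHm IHa.
  by case: b => /=; rewrite add0n -?addnA ?IHa // addnCA IHa.
have FW a b : size a = n -> size b = n -> walk (induced adj I) (F a) (F b) (ham a b).
  move E: (ham a b) => k; elim: k a E => [|k IH] a E sa sb.
    by rewrite (@d0 (F a) (F b)) ?HF //; apply: walk0.
  have [|a' [sa' E1 E2]] := ham_step _ E; first by rewrite sa sb.
  rewrite sa in sa'.
  apply: (walkS (w := F a')); last exact: IH.
  by split; [exact: FI|split; [exact: FI|apply: d1; rewrite HF]].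
pose c (a : 'I_n -> bool) := [seq a i | i <- enum 'I_n].
have sc a : size (c a) = n by rewrite size_map size_enum_ord.
have hc a b : hamming a b = ham (c a) (c b).
  rewrite /hamming cardE /enum_mem size_filter /ham /c -/(enum_mem _).
  have -> (s : seq 'I_n) : zip [seq a i | i <- s] [seq b i | i <- s] = [seq (a i, b i) | i <- s].
    by elim: s => //= i s ->.
  by rewrite count_map enumT.
exists (fun a => F (c a)); split=> [a|a b]; first exact: FI.
have W := FW _ _ (sc a) (sc b); rewrite hc.
have [W' min] := gdist_spec (ex_intro _ _ W).
have sub u v : induced adj I u v -> adj u v by case=> _ [].
have := min _ W; have := gdist_min conn (walk_le_map sub W').
by rewrite HF //; lia.
Qed.

End IntervalCube.

Lemma adjDelta_thick u v : adjDelta adj u v <-> u <> v /\ thick_pair u v.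
Proof.
split=> [[uv|[B E]]|[n T]].
- split; first by move=> e; subst; case: (adjN uv).
  have Tuu : thick_pair u u.
    exists (fun z => z = u); split=> //; first exact: gated1.
    by move=> a b -> ->; rewrite dxx.
  (* Grow from the single vertex [u]; nothing is below [u] as seen from [u]. *)
  have [|M [gM tM Mv Mu _]] := thick_grow Tuu (adjC uv); last by exists M.
  by move=> z [_]; rewrite dxx.
- split; last exact: boolean_pair_thick.
  by move=> e; subst; move: E; rewrite dxx.
case E: (d u v) => [|[|k]]; [by case: n; apply: d0|by left; apply: d1|].
by right; split; [exact: thick_boolean_pair|rewrite E].
Qed.

(** * Balls of G^Delta are gated *)

Lemma thick_pairxx x : thick_pair x x.
Proof.
exists (fun z => z = x); split=> //; first exact: gated1.
by move=> u v -> ->; rewrite dxx.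
Qed.

Lemma thick_pair_mid x o w : thick_pair x o -> d x w + d w o = d x o ->
  thick_pair x w /\ thick_pair w o.
Proof.
case=> B [gB tB Bx Bo] E; have Bw := gated_convex gB Bx Bo E.
by split; exists B.
Qed.

(* The only use of the thickness of [v, o] is to find a second common neighbour
   of [v] and a vertex two levels below it; the rest completes a cube. *)
Lemma perp_two_lower o w x v y k : thick_pair v o -> adj w x -> adj w v -> x <> v ->
  d o w = k.+2 -> d o x = k.+1 -> d o v = k.+1 -> below o x y -> perp x w y.
Proof.
move=> [B [gB tB Bv Bo]] wx wv nxv Ew Ex Ev [yx Ey].
have Eyk : d o y = k by lia.
have viav : adj y v -> perp x w y by move=> yv; constructor 3; exists v; split; auto.
have [r [rx rv Er]] := QC (adjC wx) (adjC wv) nxv Ex Ev Ew.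
case: (classic (r = y)) => [e|nry]; first by subst; apply: viav.
case: k Ew Ex Ev Eyk Er {Ey} => [|k] Ew Ex Ev Ey Er.
  by case: nry; rewrite -(d0 Er) -(d0 Ey).
have [c [cr cy Ec]] := QC rx yx nry Er Ey Ex.
have T1 := dT r v c; rewrite (dC v r) (d_adj rv) (dC r c) (d_adj cr) in T1.
have T2 := dT c o v; rewrite (dC c v) in T2.
have Evc : d v c = 2 by lia.
have Bc : B c by apply: (gated_convex gB Bv Bo); rewrite (dC c o) (dC v o); lia.
have [b [nbr bv bc]] : exists b, [/\ r <> b, adj b v & adj b c].
  have [a [b [nab av ac [bv bc]]]] := tB _ _ Bv Bc Evc.
  case: (classic (r = a)) => [e|]; last by exists a.
  by exists b; split=> //; rewrite e.
case: (classic (y = b)) => [e|nyb]; first by subst; apply: viav.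
have [L1 L2] := lip o bv; have [L3 L4] := lip o bc.
have T3 := dT w o y; have T4 := dT x w y; have T5 := dT w o b; have T6 := dT v w b.
have T7 := dT w o c; have T8 := dT y w c.
have C1 := dC w o; have C2 := dC x y; have C3 := dC v b; have C4 := dC y c.
have A1 := d_adj wx; have A2 := d_adj wv; have A3 := d_adj yx; have A4 := d_adj bv.
have A5 := d_adj cy; have T9 := dT y o w; have T10 := dT b o w; have T11 := dT c o w.
have Cy := dC y w; have Cb := dC b w; have Cc := dC c w.
have [|||e [ey eb /d1 we]] := @QC w y b c 1 (adjC cy) bc nyb; [lia|lia|lia|].
case: (classic (e = x)) => [e'|nex]; last by constructor 3; exists e; split; auto.
subst; have E3 : d c w = 3 by lia.
by case: (K33 E3 nxv nbr); auto.
Qed.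

(** Applied to a ball of G^Delta this is the next ball. Any vertex of [A] could replace the gate,
    since the gate lies between it and [x]. *)
Definition expand (A : V -> Prop) x := exists g, is_gate adj A x g /\ thick_pair x g.

Lemma expandP A x : gated adj A -> expand A x <-> exists2 z, A z & thick_pair x z.
Proof.
move=> gA; split=> [[g [[Ag _] T]]|[z Az T]]; first by exists g.
have [g Hg] := gA x; exists g; split=> //.
by apply: (proj1 (thick_pair_mid T _)); apply: (Hg.2 z Az).
Qed.

Lemma gate_nbr (A : V -> Prop) x w x' w' : is_gate adj A x x' -> is_gate adj A w w' -> adj w x ->
  x' <> w' -> [/\ adj x' w', d x x' = d w w', d x w' = (d w w').+1 & d w x' = (d w w').+1].
Proof.
move=> Hx Hw wx n; have le := gate_lip (adjC wx) Hx Hw.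
have E : d x' w' = 1 by have := d_pos n; lia.
have := Hx.2 _ Hw.1; have := Hw.2 _ Hx.1; rewrite /interval (dC w' x') E => E1 E2.
have [L1 L2] := lip x' wx; have [L3 L4] := lip w' wx.
have C1 := dC x w'; have C2 := dC w x'; have C3 := dC x x'; have C4 := dC w w'.
by split; [exact: d1|lia|lia|lia].
Qed.

(** Seen from [w'], both [w] and the neighbours of [x] towards [x'] are one level below [x], so
    [thick_grow] applies; [w'] lies between [w] and [x']. *)
Lemma expand_nbr A x w x' w' : is_gate adj A x x' -> thick_pair x x' ->
  is_gate adj A w w' -> adj w x -> x' <> w' -> thick_pair w w'.
Proof.
move=> Hx Tx Hw wx n; have [xw' E1 E2 E3] := gate_nbr Hx Hw wx n.
have [|M [gM tM Mw Mx Mx']] := thick_grow Tx wx.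
  move=> y [yx Ey]; apply: (@perp_lower w' x w y (d w w')) => //; try by rewrite dC.
  have [L1 _] := lip w' yx; have := dT x' w' y; have [_ L2] := lip w' yx.
  have := d_adj xw'; have := dC x' w'; have := dC x x'; have := dC x w'; lia.
exists M; split=> //; apply: (gated_convex gM Mw Mx').
by rewrite E3 (dC w' x') (d_adj xw') addn1.
Qed.

Lemma thick_pair_level x o w : thick_pair x o -> adj w x -> d o w <= d o x -> thick_pair w o.
Proof.
move=> T wx le; have [L1 L2] := lip o wx.
case Ex: (d o x) le => [|k] le.
  by rewrite (@d0 o w); [apply: thick_pairxx|lia].
case: (ltnP (d o w) k.+1) => [lt|ge].
  by apply: (proj2 (thick_pair_mid T _)); rewrite (dC x w) (d_adj wx) (dC w) (dC x o); lia.
have [|r [rx rw Er]] := TC (adjC wx) Ex; first lia.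
have [B [gB tB Bx Bo]] := T.
have Br : B r by apply: (gated_convex gB Bx Bo); rewrite (dC x r) (d_adj rx) (dC r) (dC x o); lia.
exists B; split=> //; apply: (gated_closed gB Bx Br _ wx (adjC rw)).
by move=> e; subst; case: (adjN rx).
Qed.

Lemma expand_sub (A : V -> Prop) z : A z -> expand A z.
Proof. by move=> Az; exists z; split; [apply: gate_self|apply: thick_pairxx]. Qed.

(** If [x] or [v] has another gate than [w], use [expand_nbr]; if one of them is no nearer to the
    common gate than [w], use [thick_pair_level]; if both are nearer, [perp_two_lower] lets the hull
    grow. *)
Lemma expand_closed A : gated adj A -> nbr_closed (expand A).
Proof.
move=> gA x v w [x' [Hx Tx]] [v' [Hv Tv]] nxv wx wv.
have [o Ho] := gA w; exists o; split=> //.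
case: (classic (x' = o)) => [e|n]; last exact: (expand_nbr Hx Tx Ho wx n).
case: (classic (v' = o)) => [e'|n]; last exact: (expand_nbr Hv Tv Ho wv n).
subst x' v'; have [L1 L2] := lip o wx; have [L3 L4] := lip o wv.
case: (leqP (d o w) (d o x)) => [le|lx]; first exact: (thick_pair_level Tx wx le).
case: (leqP (d o w) (d o v)) => [le|lv]; first exact: (thick_pair_level Tv wv le).
case Ex : (d o x) => [|k]; first by case: nxv; rewrite -(d0 Ex); apply: d0; lia.
have [|M [gM tM Mw Mx Mo]] := thick_grow Tx wx; last by exists M.
move=> y By; apply: (perp_two_lower Tv wx wv nxv _ Ex _ By); lia.
Qed.

Lemma expand_walk A x g : is_gate adj A x g -> thick_pair x g ->
  exists n, walk (induced adj (expand A)) x g n.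
Proof.
move E: (d x g) => n; elim: n x E => [|n IH] x E Hg T.
  by exists 0; rewrite (d0 E); apply: walk0.
have [w [xw Ew]] := step E.
have Hw : is_gate adj A w g.
  split=> [|y Ay]; first exact: Hg.1.
  have := Hg.2 y Ay; rewrite /interval => E1.
  by have := dT w x y; have := dT g w y; rewrite (d_adj xw); lia.
have [_ Tw] : thick_pair x w /\ thick_pair w g.
  by apply: thick_pair_mid T _; rewrite (d_adj xw); lia.
have [m W] := IH w Ew Hw Tw; exists m.+1; apply: walkS W.
by split; [exists g|split=> //; exists g].
Qed.

Lemma expand_gated A : gated adj A -> gated adj (expand A).
Proof.
move=> gA x; have [a [Aa _]] := gA x.
apply: (@gated_intro (expand A)); [by exists a; apply: expand_sub|exact: expand_closed|].
move=> u v [u' [Hu Tu]] [v' [Hv Tv]].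
have [m W1] := expand_walk Hu Tu; have [n W2] := expand_walk Hv Tv.
have W := convex_walk (fun b c z => @gated_convex A b c z gA) Hu.1 Hv.1.
have sub b c : induced adj A b c -> induced adj (expand A) b c.
  by case=> Ab [Ac bc]; split; [|split=> //]; apply: expand_sub.
have symi b c : induced adj (expand A) b c -> induced adj (expand A) c b.
  by case=> Ab [Ac bc]; split=> //; split; auto.
exists (m + (d u' v' + n)); apply: (walk_cat W1); apply: (walk_cat (walk_le_map sub W)).
exact: (walkC symi W2).
Qed.

(** With different gates, [v] and [u] are both below [x] seen from the gate of [v]. With one gate,
    compare levels: [v] lower gives a square below [x], [v] higher a common thick set, and equal
    level a line through a lower neighbour. *)
Lemma expand_perp A x v x' u : is_gate adj A x x' -> gated adj A -> expand A v -> adj v x ->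
  below x' x u -> perp x v u.
Proof.
move=> Hx gA [v' [Hv Tv]] vx [ux Eu]; have [L1 L2] := lip x' vx.
case: (classic (x' = v')) => [e|n]; last first.
  have [a E1 E2 E3] := gate_nbr Hx Hv vx n.
  have [L3 L4] := lip v' ux; have T := dT x' v' u; have A1 := d_adj a.
  have C1 := dC x' v'; have C2 := dC x x'; have C3 := dC x v'; have C4 := dC v v'.
  by apply: (@perp_lower v' x v u (d v v')) => //; lia.
subst v'; set o := x' in Hx Hv Tv Eu L1 L2 *.
case: (ltngtP (d o v) (d o x)) => [lt|gt|E].
- by apply: (@perp_lower o x v u (d o u)) => //; lia.
- have [B [gB tB Bv Bo]] := Tv.
  have Bx : B x by apply: (gated_convex gB Bv Bo); rewrite (d_adj vx) (dC x) (dC v); lia.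
  have Bu : B u by apply: (gated_convex gB Bx Bo); rewrite (dC x u) (d_adj ux) (dC u) (dC x); lia.
  exact: thick_perp tB Bv Bu vx ux.
rewrite Eu in E; have [w [wx wv Ew]] := TC (adjC vx) Eu E.
apply: perpC; apply: (perp_line ux wx vx (adjC wv)).
by apply: (@perp_lower o x u w (d o u)).
Qed.


(** * Distances and balls of G^Delta *)

Notation aD := (adjDelta adj).
Notation dD := (distDelta adj).

Lemma aDC u v : aD u v -> aD v u.
Proof.
by move=> /adjDelta_thick [n /thick_pairC T]; apply/adjDelta_thick; split=> // e; apply: n.
Qed.

Lemma aD_conn : connected aD.
Proof.
by move=> u v; have [n W] := conn u v; exists n; apply: walk_le_map W => a b ab; left.
Qed.

Lemma dDxx u : dD u u = 0. Proof. exact: gdistxx aD_conn u. Qed.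
Lemma dD0 u v : dD u v = 0 -> u = v. Proof. exact: gdist_eq0 aD_conn u v. Qed.

Lemma dD_thick p u v : thick_pair u v -> dD p u <= (dD p v).+1.
Proof.
move=> T; case: (classic (u = v)) => [->|n]; first exact: leqnSn.
have uv : aD u v by apply/adjDelta_thick.
have := gdist_tri aD_conn v p u; have := gdist_adj1 aD_conn (aDC uv).
rewrite -/(dD p u) -/(dD p v) -/(dD v u); lia.
Qed.

Definition ball p i z := dD p z <= i.

Lemma ball_expand p i z : gated adj (ball p i) -> (expand (ball p i) z <-> ball p i.+1 z).
Proof.
move=> gB; split=> [[g [[Bg _] /dD_thick T]]|].
  by have := T p; rewrite /ball in Bg *; lia.
rewrite /ball leq_eqVlt => /orP [/eqP E|lt]; last by apply: expand_sub; rewrite /ball; lia.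
apply/expandP => //; have : dD z p = i.+1 by rewrite -E; exact: gdistC aDC aD_conn z p.
move=> /(gdist_step aD_conn) [w [/adjDelta_thick [_ T] Ew]]; exists w => //.
by rewrite /ball /distDelta (gdistC aDC aD_conn) Ew.
Qed.

Lemma ball_gated p i : gated adj (ball p i).
Proof.
have ext (A B : V -> Prop) : (forall z, A z <-> B z) -> gated adj A -> gated adj B.
  move=> AB gA x; have [g [Ag Hg]] := gA x; exists g.
  by split=> [|y /AB /Hg]; [apply/AB|].
elim: i => [|i IH]; last by apply: (ext _ _ (fun z => ball_expand z IH)); apply: expand_gated.
apply: (ext _ _ _ (gated1 p)) => z; split=> [->|]; rewrite /ball ?dDxx //.
by rewrite leqn0 => /eqP /dD0.
Qed.

(** * Normal Boolean-gated paths *)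

Lemma ball_gate p i z g : dD p z = i.+1 -> is_gate adj (ball p i) z g ->
  [/\ thick_pair z g, aD g z & dD p g = i].
Proof.
move=> Ez Hg; have /(ball_expand z (ball_gated p i)) : ball p i.+1 z by rewrite /ball Ez.
case=> g' [Hg' T]; rewrite (gate_uniq Hg' Hg) in T; have [Bg _] := Hg.
have n : g <> z by move=> e; subst; rewrite /ball Ez ltnn in Bg.
split=> //; first by apply/adjDelta_thick; split=> //; apply: thick_pairC.
by have := dD_thick p T; rewrite /ball in Bg; lia.
Qed.

Lemma delta_gateP p z g i : dD p z = i.+1 -> is_gate adj (ball p i) z g -> delta_gate adj p z g.
Proof.
by move=> Ez Hg; split; [move=> e; subst; rewrite dDxx in Ez|rewrite Ez].
Qed.

Lemma gate_normal p i a b c B z : dD p a <= i -> dD p c = i.+2 ->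
  is_gate adj (ball p i.+1) c b -> boolean_gated adj B ->
  (forall u, gated_hull adj a b u -> B u) -> (B z /\ gated_hull adj b c z) <-> z = b.
Proof.
move=> Ea Ec Hb /boolean_gated_thick [gB tB] HB.
split=> [[Bz Hz]|->]; last by split; [apply: HB; apply: hull_r|apply: hull_l].
have Tza : thick_pair z a by exists B; split=> //; apply: HB; apply: hull_l.
have [Tcb _ _] := ball_gate Ec Hb.
have Bz' : ball p i.+1 z by have := dD_thick p Tza; rewrite /ball; lia.
(* The gate [b] lies between [c] and [z], while [z] is no farther from [c] than [b] is. *)
have := Hb.2 z Bz'; have := hull_ecc (thick_pairC Tcb) Hz; rewrite /interval => le E.
by symmetry; apply: d0; lia.
Qed.

Lemma normal_gate p i a b c : dD p b = i.+1 -> is_gate adj (ball p i) b a -> aD b c ->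
  (forall B, boolean_gated adj B -> (forall u, gated_hull adj a b u -> B u) ->
     forall z, (B z /\ gated_hull adj b c z) <-> z = b) ->
  is_gate adj (ball p i.+1) c b.
Proof.
move=> Eb Ha /adjDelta_thick [nbc Tbc] HN.
have [g Hg] := ball_gated p i.+1 c; case: (classic (g = b)) => [<- //|ngb].
have Bb : ball p i.+1 b by rewrite /ball Eb.
have Ig := Hg.2 b Bb; rewrite /interval in Ig.
have [Tba _ _] := ball_gate Eb Ha.
have [m Em] : exists m, d b g = m.+1.
  by case E: (d b g) => [|m]; [case: ngb; rewrite (d0 E)|exists m].
have [v [bv Ev]] := step Em; have Evg : d b v + d v g = d b g by rewrite (d_adj bv) Ev Em.
have Bv : ball p i.+1 v := gated_convex (ball_gated p i.+1) Bb Hg.1 Evg.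
(* [b], [v], [g], [c] occur in this order on a geodesic. *)
have Hv : gated_hull adj b c v.
  have gH := gated_hull_gated b c.
  have Hbg := gated_convex gH (@hull_r b c) (@hull_l b c) Ig.
  exact: (gated_convex gH (@hull_l b c) Hbg Evg).
(* [v] lies in the ball of radius [i.+1], the expansion of the ball of radius [i], so [expand_perp]
   supplies the squares. *)
have [|M [gM tM Mv Mb Ma]] := thick_grow Tba (adjC bv).
  move=> u Hu; apply: (expand_perp Ha (ball_gated p i) _ (adjC bv) Hu).
  by apply/ball_expand => //; apply: ball_gated.
have bM : boolean_gated adj M by apply/boolean_gated_thick.
have [+ _] := HN M bM (fun u Hu => Hu M gM Ma Mb) v.
by move=> /(_ (conj Mv Hv)) e; subst; case: (adjN bv).
Qed.

Lemma normal_path_gates y m : normal_bg_path adj y m -> forall i, i <= m ->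
  dD (y 0) (y i) = i /\ forall j, i = j.+1 -> is_gate adj (ball (y 0) j) (y i) (y j).
Proof.
move=> [Hadj HN]; elim=> [|i IH] lt; first by rewrite dDxx.
have [Ei Hi] := IH (ltnW lt); have ad := Hadj i lt.
have Hg : is_gate adj (ball (y 0) i) (y i.+1) (y i).
  case: i {IH} lt Ei Hi ad => [|i] lt Ei Hi ad; last first.
    exact: (normal_gate Ei (Hi i (erefl _)) ad (HN i.+1 isT lt)).
  split=> [|z]; rewrite /ball ?dDxx // leqn0 => /eqP /dD0 <-.
  by rewrite /interval dxx addn0.
split=> [|j [<-]//].
have /adjDelta_thick [n T] := ad.
(* If [y i.+1] were in the ball of radius [i], it would be its own gate and equal [y i]. *)
have := dD_thick (y 0) (thick_pairC T); rewrite Ei leq_eqVlt => /orP [/eqP //|le].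
by case: n; apply: (gate_uniq Hg (gate_self (S := ball (y 0) i) le)).
Qed.

End SwmGraph.

(** * Existence and uniqueness of the normal Boolean-gated path *)

Theorem theorem6p24 (V : Type) (adj : V -> V -> Prop) (HG : swm_graph adj) (p q : V) :
  let k := distDelta adj p q in
  (exists x : nat -> V,
     [/\ x 0%N = p, x k = q, normal_bg_path adj x k,
         (forall i, (i < k)%N -> delta_gate adj p (x i.+1) (x i)) &
         (forall (y : nat -> V) (m : nat), y 0%N = p -> y m = q ->
            normal_bg_path adj y m -> m = k /\ forall i, (i <= m)%N -> y i = x i)])
  /\ (forall (y : nat -> V) (m : nat), normal_bg_path adj y m ->
        m = distDelta adj (y 0%N) (y m)).
Proof.
move=> k; split; last by move=> y m /(normal_path_gates HG) /(_ m (leqnn m)) [].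
pose gate i z := epsilon (inhabits z) (is_gate adj (ball adj p i) z).
have gateP i z : is_gate adj (ball adj p i) z (gate i z).
  by apply: epsilon_spec; apply: ball_gated.
(* The recursion runs from [q] towards [p]: [h j] will be at G^Delta-distance [k - j] from [p], and
   [x] reverses the index. *)
pose h := fix h j := if j is j'.+1 then gate (k - j'.+1) (h j') else q.
have hd j : j <= k -> distDelta adj p (h j) = k - j.
  elim: j => [|j IH] le; first by rewrite subn0.
  have E : distDelta adj p (h j) = (k - j.+1).+1 by rewrite IH; lia.
  by have [] := ball_gate HG E (gateP _ _).
pose x i := h (k - i).
have xd i : i <= k -> distDelta adj p (x i) = i by move=> le; rewrite hd; lia.
have xg i : i < k -> is_gate adj (ball adj p i) (x i.+1) (x i).
  move=> lt; rewrite /x (_ : k - i = (k - i.+1).+1) /=; last lia.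
  by rewrite (_ : k - (k - i.+1).+1 = i) //; lia.
exists x; split.
- by symmetry; apply: (dD0 HG); apply: xd.
- by rewrite /x subnn.
- split=> [i lt|[|i] // _ lt B bB HB z].
    by have [] := ball_gate HG (xd _ lt) (xg _ lt).
  have le : distDelta adj p (x i) <= i by rewrite xd //; lia.
  exact: (@gate_normal _ _ HG p i _ _ _ B z le (xd _ lt) (xg _ lt) bB HB).
- by move=> i lt; apply: (delta_gateP HG (xd _ lt)); apply: xg.
move=> y m y0 ym Hy; have Hg := normal_path_gates HG Hy; rewrite y0 in Hg.
have Em : m = k by have [] := Hg m (leqnn m); rewrite ym.
(* Descending induction from [q]: [y i] and [x i] are gates of the same vertex in the same ball. *)
split=> // i; rewrite Em => le; rewrite -(subKn le).
elim: (k - i) (leq_subr i k) => [|j IH] lej; first by rewrite subn0 -{1}Em ym /x subnn.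
have E : k - j = (k - j.+1).+1 by lia.
have [|_ /(_ _ E) G1] := Hg (k - j); first by rewrite Em leq_subr.
have := xg (k - j.+1); rewrite -E => G2.
rewrite IH in G1; last lia.
by apply: (gate_uniq HG G1); apply: G2; lia.
Qed.
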